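(* Let $J:\widehat{A}\to H\otimes H$ be a dynamical twist. Let $K$ be an $H$-simple left $H$-comodule algebra with $K^{\mathrm{co}H}=\Bbbk$ and let $(F,c):\mathcal{M}^{(J)}\to{}_K\mathcal{M}$ be an equivalence of module categories over $\mathrm{Rep}(H)$. Set $V_\lambda=F(\Bbbk_{\lambda^{-1}})$ for $\lambda\in\widehat{A}$. Then $(K,\{V_\lambda\}_{\lambda\in\widehat{A}})$ is a dynamical datum for $(H,A)$.
   Context: **Conventions.** $\Bbbk$ is an algebraically closed field of characteristic $0$; $H$ is a finite-dimensional Hopf algebra over $\Bbbk$ with comultiplication $\Delta$, counit $\varepsilon$, antipode $\mathcal{S}$; $A$ is a finite abelian subgroup of the group $G(H)$ of group-like elements; $\widehat{A}$ is its character group. For $\mu\in\widehat{A}$, $P_\mu=\frac{1}{|A|}\sum_{a\in A}\mu(a^{-1})a$, $\Bbbk_\mu$ is the one-dimensional $A$-module given by $\mu$, and for an $A$-module $V$, $V[\mu]=\{v: a\cdot v=\mu(a)v\ \forall a\in A\}$. $\mathrm{Rep}(H)$ is the tensor category of finite-dimensional left $H$-modules. All modules are finite-dimensional. **Dynamical twists.** A dynamical twist is a function $J:\widehat{A}\to H\otimes H$ with invertible values such that for all $\lambda\in\widehat{A}$, $a\in A$: $J(\lambda)(a\otimes a)=(a\otimes a)J(\lambda)$; $\sum_{\mu\in\widehat{A}}(\Delta\otimes \mathrm{id})J(\lambda)\,(J(\lambda\mu^{-1})\otimes P_\mu)=(\mathrm{id}\otimes\Delta)J(\lambda)\,(1\otimes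 J(\lambda))$; $(\varepsilon\otimes \mathrm{id})J(\lambda)=(\mathrm{id}\otimes\varepsilon)J(\lambda)=1$. The inverse of $J(\lambda)$ is written $J^{-1}(\lambda)\otimes J^{-2}(\lambda)$ (sum understood). **Module categories.** A module category over $\mathrm{Rep}(H)$ is an abelian category $\mathcal{M}$ with an exact bifunctor $\overline{\otimes}:\mathrm{Rep}(H)\times\mathcal{M}\to\mathcal{M}$ and natural associativity isomorphisms $m_{X,Y,M}:(X\otimes Y)\overline{\otimes}M\to X\overline{\otimes}(Y\overline{\otimes}M)$ and unit isomorphisms $l_M$ satisfying the usual pentagon and triangle axioms. A module functor is a functor $F$ with natural isomorphisms $c_{X,M}:F(X\overline{\otimes}M)\to X\overline{\otimes}F(M)$ satisfying $m'_{X,Y,F(M)}c_{X\otimes Y,M}=(\mathrm{id}_X\otimes c_{Y,M})c_{X,Y\overline{\otimes}M}F(m_{X,Y,M})$ and $l'_{F(M)}c_{\mathbf 1,M}=F(l_M)$; it is an equivalence of module categories if $F$ is an equivalence. $\mathcal{M}^{(J)}$ is the category of finite-dimensional left $\Bbbk[A]$-modules with $X\overline{\otimes}V=X\otimes_{\Bbbk}V$ (diagonal $A$-action), trivial unit isomorphism, and $m_{X,Y,V}((x\otimes y)\otimes n)=J^{-1}(\lambda)x\otimes J^{-2}(\lambda)y\otimes n$ for $n\in V[\lambda^{-1}]$. A (finite-dimensional) left $H$-comodule algebra $K$ with coaction $\delta(k)=k_{(-1)}\otimes k_{(0)}$ is $H$-simple if it has no non-trivial two-sided ideal $I$ with $\delta(I)\subseteq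 H\otimes I$; $K^{\mathrm{co}H}=\{k:\delta(k)=1\otimes k\}$. The category ${}_K\mathcal{M}$ of finite-dimensional left $K$-modules is a module category over $\mathrm{Rep}(H)$ via $X\overline{\otimes}V=X\otimes_{\Bbbk}V$, $k\cdot(x\otimes v)=k_{(-1)}x\otimes k_{(0)}v$, with canonical associativity and unit isomorphisms. **Yan–Zhu stabilizers.** For left $K$-modules $V,W$, let $\mathcal{L}:H^*\otimes\mathrm{Hom}(V,W)\to\mathrm{Hom}(H^*\otimes V,H^*\otimes W)$, $\mathcal{L}(\gamma\otimes T)(\xi\otimes v)=\gamma\xi\otimes T(v)$, and $\mathrm{Stab}_K(V,W)=\mathrm{Hom}_K(H^*\otimes V,H^*\otimes W)\cap\mathcal{L}(H^*\otimes\mathrm{Hom}(V,W))$, where $K$ acts on $H^*\otimes V$ by $k\cdot(\gamma\otimes v)=(k_{(-1)}\rightharpoondown\gamma)\otimes k_{(0)}v$ with $\langle h\rightharpoondown\gamma,t\rangle=\langle\gamma,\mathcal{S}^{-1}(h)t\rangle$. Elements of $H^*\otimes \mathrm{Hom}(V,W)$ are regarded as linear functions $G:H\to\mathrm{Hom}(V,W)$, and $H$ acts by $(h\cdot G)(t)=G(th)$. For $\mu\in\widehat{A}$, $C(\mu)=\{f\in H^*: f(ah)=\mu(a)f(h)\ \forall a\in A,h\in H\}$, an $H$-module via $(h\cdot f)(t)=f(th)$. **Dynamical data.** A dynamical datum for $(H,A)$ is $(K,\{V_\lambda\}_{\lambda\in\widehat{A}})$ where $K$ is an $H$-simple left $H$-comodule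 algebra, semisimple as an algebra, with $K^{\mathrm{co}H}=\Bbbk$, and $V_\lambda$ are irreducible $K$-modules such that for all $\lambda,\mu\in\widehat{A}$ there are $H$-module isomorphisms $\mathrm{Stab}_K(V_\lambda,V_\mu)\simeq C(\lambda\mu^{-1})$. *)

(* Defs.v *)
(* Finite-dimensional Hopf algebras, comodule algebras, the module categories
   of modules over a comodule algebra and of a dynamical twist, Yan-Zhu
   stabilizers and dynamical data.  All vector spaces are vectTypes, hence
   finite dimensional. *)
From HB Require Import structures.
From mathcomp Require Import all_boot all_fingroup all_algebra all_solvable all_field.

Set Implicit Arguments.
Unset Strict Implicit.
Unset Printing Implicit Defensive.

Import GRing.Theory.
Local Open Scope ring_scope.

Reserved Notation "v ⊗ w" (at level 39, left associativity).

Section Tensor.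
Variable k : fieldType.
Implicit Types U V W : vectType k.

(* V ⊗ W is the space of coordinate matrices with respect to the chosen bases
   of V and W; tlift, tliftE and text express its universal property. *)
Definition tens V W : Type := 'M[k]_(\dim {:V}, \dim {:W}).

HB.instance Definition _ V W := Vector.copy (tens V W) 'M[k]_(\dim {:V}, \dim {:W}).

(* The chosen basis of V and its coordinate functions. *)
Definition bv V (i : 'I_(\dim {:V})) : V := (vbasis {:V})`_i.
Definition bc V (i : 'I_(\dim {:V})) (v : V) : k := coord (vbasis {:V}) i v.

Definition tpure V W (v : V) (w : W) : tens V W := \matrix_(i, j) (bc i v * bc j w).
Local Notation "v ⊗ w" := (tpure v w).

(* The linear map V ⊗ W -> U induced by b, which is meaningful when b is
   bilinear (see tliftE). *)
Definition tlift_fun V W U (b : V -> W -> U) (t : tens V W) : U :=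
  \sum_i \sum_j t i j *: b (bv i) (bv j).

Definition tlift V W U (b : V -> W -> U) : 'Hom(tens V W, U) :=
  linfun (tlift_fun b).

Definition bilin V W U (b : V -> W -> U) : Prop :=
  (forall w, linear (b^~ w)) /\ (forall v, linear (b v)).

Lemma bvE V (v : V) : v = \sum_i bc i v *: bv i.
Proof. by rewrite [LHS](coord_vbasis (memvf v)). Qed.

Lemma bc_bv V i j : bc i (bv j : V) = (i == j)%:R.
Proof. by rewrite /bc /bv coord_free ?(basis_free (vbasisP _)) // eq_sym. Qed.

Lemma bcP V i c (u v : V) : bc i (c *: u + v) = c * bc i u + bc i v.
Proof. by rewrite /bc linearP. Qed.

Lemma tpurePl V W c (u v : V) (w : W) : (c *: u + v) ⊗ w = c *: (u ⊗ w) + v ⊗ w.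
Proof. by apply/matrixP=> i j; rewrite !mxE bcP mulrDl mulrA. Qed.

Lemma tpurePr V W c (u v : W) (w : V) : w ⊗ (c *: u + v) = c *: (w ⊗ u) + w ⊗ v.
Proof. by apply/matrixP=> i j; rewrite !mxE bcP mulrDr mulrCA. Qed.

HB.instance Definition _ V W (v : V) :=
  GRing.isLinear.Build k W (tens V W) _ (tpure v) (fun c x y => tpurePr c x y v).

Definition tpurer V W (w : W) (v : V) := v ⊗ w.
HB.instance Definition _ V W (w : W) :=
  GRing.isLinear.Build k V (tens V W) _ (tpurer w) (fun c x y => tpurePl c x y w).

Lemma tpureZl V W c (v : V) (w : W) : (c *: v) ⊗ w = c *: (v ⊗ w).
Proof. exact: (linearZZ (tpurer w)). Qed.
Lemma tpureZr V W c (v : V) (w : W) : v ⊗ (c *: w) = c *: (v ⊗ w).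
Proof. exact: linearZZ. Qed.
Lemma tpureDl V W (u v : V) (w : W) : (u + v) ⊗ w = u ⊗ w + v ⊗ w.
Proof. exact: (linearD (tpurer w)). Qed.
Lemma tpureDr V W (v : V) (u w : W) : v ⊗ (u + w) = v ⊗ u + v ⊗ w.
Proof. exact: linearD. Qed.
Lemma tpure_suml V W I r (P : pred I) (v : I -> V) (w : W) :
  (\sum_(i <- r | P i) v i) ⊗ w = \sum_(i <- r | P i) v i ⊗ w.
Proof. exact: (linear_sum (tpurer w)). Qed.

Lemma tpure_bilin V W : bilin (@tpure V W).
Proof. by split=> x c y z; rewrite (tpurePl, tpurePr). Qed.

Lemma tensE V W (t : tens V W) : t = \sum_i \sum_j t i j *: (bv i ⊗ bv j).
Proof.
apply/matrixP=> i j; rewrite summxE (bigD1 i) //= summxE (bigD1 j) //= !mxE.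
rewrite !bc_bv !eqxx !mulr1 !big1 ?addr0 //.
  move=> i' ne; rewrite summxE big1 // => j' _.
  by rewrite !mxE !bc_bv eq_sym (negPf ne) mul0r mulr0.
by move=> j' ne; rewrite !mxE !bc_bv [j == j']eq_sym (negPf ne) mulr0 mulr0.
Qed.

Lemma tens_ind V W (P : tens V W -> Prop) :
  (forall a b, P (a ⊗ b)) -> (forall c s t, P s -> P t -> P (c *: s + t)) ->
  forall t, P t.
Proof.
move=> Pp PD t; have P0 : P 0.
  by have := PD (-1) _ _ (Pp 0 0) (Pp 0 0); rewrite scaleN1r addNr.
rewrite (tensE t); apply: (big_ind P) => // [x y Px Py|i _].
  by rewrite -[x]scale1r; apply: PD.
apply: (big_ind P) => // [x y Px Py|j _]; first by rewrite -[x]scale1r; apply: PD.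
by rewrite -[_ *: _]addr0; apply: PD.
Qed.

Section Lift.
Variables (V W U : vectType k) (b : V -> W -> U).

Fact tlift_linear : linear (tlift_fun b).
Proof.
rewrite /tlift_fun => c s t.
rewrite scaler_sumr -big_split; apply: eq_bigr => i _ /=.
rewrite scaler_sumr -big_split; apply: eq_bigr => j _ /=.
by rewrite !mxE scalerDl scalerA.
Qed.
HB.instance Definition _ := GRing.isLinear.Build k (tens V W) U _ _ tlift_linear.

Lemma tliftE (v : V) (w : W) : bilin b -> tlift b (v ⊗ w) = b v w.
Proof.
case=> bl br; pose Bl w := linfun (b^~ w); rewrite lfunE /=.
have lE w' : b^~ w' =1 fun_of_lfun (linfun (b^~ w')).
  pose m := GRing.isLinear.Build k V U _ (b^~ w') (bl w').
  pose L : {linear V -> U} := HB.pack (b^~ w') m.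
  by move=> x; rewrite (lfunE L).
have rE v' : b v' =1 fun_of_lfun (linfun (b v')).
  pose m := GRing.isLinear.Build k W U _ (b v') (br v').
  pose L : {linear W -> U} := HB.pack (b v') m.
  by move=> x; rewrite (lfunE L).
rewrite [in RHS](bvE v) [RHS](lE w) linear_sum; apply: eq_bigr => i _.
rewrite linearZ /= -lE [in RHS](bvE w) rE linear_sum scaler_sumr.
by apply: eq_bigr => j _; rewrite linearZ /= -rE !mxE scalerA.
Qed.
End Lift.

Lemma text V W U (f g : 'Hom(tens V W, U)) :
  (forall v w, f (v ⊗ w) = g (v ⊗ w)) -> f = g.
Proof.
move=> fg; apply/lfunP=> t; rewrite (tensE t) !linear_sum; apply: eq_bigr => i _.
by rewrite !linear_sum; apply: eq_bigr => j _; rewrite !linearZ /= fg.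
Qed.

Definition tmap V V' W W' (f : 'Hom(V, V')) (g : 'Hom(W, W')) :
    'Hom(tens V W, tens V' W') :=
  tlift (fun v w => f v ⊗ g w).

Lemma tmapE V V' W W' (f : 'Hom(V, V')) (g : 'Hom(W, W')) v w :
  tmap f g (v ⊗ w) = f v ⊗ g w.
Proof. by rewrite tliftE //; split=> x c y z; rewrite linearP (tpurePl, tpurePr). Qed.

Lemma tmap1 V W : tmap \1%VF \1%VF = \1%VF :> 'End(tens V W).
Proof. by apply: text => v w; rewrite tmapE !id_lfunE. Qed.

Lemma tmap_comp V V' V'' W W' W'' (f' : 'Hom(V', V'')) (f : 'Hom(V, V'))
    (g' : 'Hom(W', W'')) (g : 'Hom(W, W')) :
  (tmap f' g' \o tmap f g)%VF = tmap (f' \o f) (g' \o g).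
Proof. by apply: text => v w; rewrite !comp_lfunE !tmapE !comp_lfunE. Qed.

Lemma tmap_bilin V V' W W' : bilin (@tmap V V' W W').
Proof.
split=> x c y z; apply: text => v w.
  by rewrite add_lfunE scale_lfunE !tmapE add_lfunE scale_lfunE tpurePl.
by rewrite add_lfunE scale_lfunE !tmapE add_lfunE scale_lfunE tpurePr.
Qed.

Definition tassoc U V W : 'Hom(tens (tens U V) W, tens U (tens V W)) :=
  tlift (fun t w => tlift (fun u v => u ⊗ (v ⊗ w)) t).

Lemma tassocE U V W (u : U) (v : V) (w : W) :
  tassoc U V W ((u ⊗ v) ⊗ w) = u ⊗ (v ⊗ w).
Proof.
have bl w' : bilin (fun u v => u ⊗ (v ⊗ w') : tens U (tens V W)).
  by split=> x c y z; rewrite ?tpurePl ?tpurePr.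
rewrite tliftE; first by rewrite tliftE.
split=> [w' | t] c y z; first exact: linearP.
rewrite -scale_lfunE -add_lfunE; congr (fun_of_lfun _ t).
by apply: text => u' v'; rewrite add_lfunE scale_lfunE !tliftE // !tpurePr.
Qed.

Definition tunitl V : 'Hom(tens k^o V, V) := tlift (fun (c : k^o) v => c *: v).
Definition tunitr V : 'Hom(tens V k^o, V) := tlift (fun v (c : k^o) => c *: v).

Lemma tunitlE V (c : k^o) (v : V) : tunitl V (c ⊗ v) = c *: v.
Proof.
by rewrite tliftE //; split=> x a y z /=; rewrite ?scalerDl ?scalerDr ?scalerA // mulrC.
Qed.
Lemma tunitrE V (c : k^o) (v : V) : tunitr V (v ⊗ c) = c *: v.
Proof.
by rewrite tliftE //; split=> x a y z /=; rewrite ?scalerDl ?scalerDr ?scalerA // mulrC.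
Qed.
End Tensor.
Arguments tunitl {k V}.
Arguments tunitr {k V}.
Arguments tassoc {k U V W}.

Notation "v ⊗ w" := (tpure v w) : ring_scope.

Section TensorAlgebra.
Variables (k : fieldType) (R S : falgType k).

(* (a ⊗ b) * (c ⊗ d) = (a * c) ⊗ (b * d), see tpureM. *)
Definition tmul (s t : tens R S) : tens R S :=
  tlift (fun a b => tlift (fun c d => (a * c) ⊗ (b * d)) t) s.

Lemma tmul_bl (a : R) (b : S) : bilin (fun (c : R) (d : S) => (a * c) ⊗ (b * d)).
Proof. by split=> x c y z; rewrite mulrDr -scalerAr (tpurePl, tpurePr). Qed.

Lemma tmul_bl2 t : bilin (fun (a : R) (b : S) => tlift (fun (c : R) (d : S) => (a * c) ⊗ (b * d)) t).
Proof.
split=> x c y z; rewrite -scale_lfunE -add_lfunE; congr (fun_of_lfun _ t);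
  apply: text => u' v'; rewrite add_lfunE scale_lfunE !tliftE; try exact: tmul_bl.
- by rewrite mulrDl -scalerAl tpurePl.
- by rewrite mulrDl -scalerAl tpurePr.
Qed.

Lemma tmulE a b c d : tmul (a ⊗ b) (c ⊗ d) = (a * c) ⊗ (b * d).
Proof. by rewrite /tmul tliftE ?tliftE //; [exact: tmul_bl | exact: tmul_bl2]. Qed.

Lemma tmulPl c s t u : tmul (c *: s + t) u = c *: tmul s u + tmul t u.
Proof. exact: linearP. Qed.

Lemma tmulPr c s t u : tmul u (c *: s + t) = c *: tmul u s + tmul u t.
Proof.
rewrite /tmul -scale_lfunE -add_lfunE; congr (fun_of_lfun _ u).
apply: text => v w; rewrite add_lfunE scale_lfunE !tliftE; try exact: tmul_bl2.
exact: linearP.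
Qed.

Fact tmulA : associative tmul.
Proof.
move=> s t u; elim/tens_ind: s => [a b|c s s' IH IH']; last first.
  by rewrite !tmulPl IH IH'.
elim/tens_ind: t => [a' b'|c s s' IH IH']; last first.
  by rewrite !(tmulPl, tmulPr) IH IH'.
elim/tens_ind: u => [a'' b''|c s s' IH IH']; last first.
  by rewrite !tmulPr IH IH'.
by rewrite !tmulE !mulrA.
Qed.

Fact tmul1t : left_id (1 ⊗ 1) tmul.
Proof.
move=> s; elim/tens_ind: s => [a b|c s s' IH IH']; first by rewrite tmulE !mul1r.
by rewrite tmulPr IH IH'.
Qed.

Fact tmult1 : right_id (1 ⊗ 1) tmul.
Proof.
move=> s; elim/tens_ind: s => [a b|c s s' IH IH']; first by rewrite tmulE !mulr1.
by rewrite tmulPl IH IH'.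
Qed.

Fact tmulDl : left_distributive tmul +%R.
Proof. by move=> s t u; rewrite -[s]scale1r tmulPl !scale1r. Qed.
Fact tmulDr : right_distributive tmul +%R.
Proof. by move=> u s t; rewrite -[s]scale1r tmulPr !scale1r. Qed.

Fact tone_neq0 : (1 : R) ⊗ (1 : S) != 0.
Proof.
apply/eqP=> t0.
have nz (T : falgType k) : exists i, bc i (1 : T) != 0.
  apply/existsP; apply: contraR (oner_neq0 T) => /existsPn h.
  by rewrite [1]bvE big1 // => i _; move/negPn/eqP: (h i) => ->; rewrite scale0r.
have [[i hi] [j hj]] := (nz R, nz S).
have /eqP := congr1 (fun M : 'M_(_, _) => M i j) t0.
by rewrite !mxE mulf_eq0 (negPf hi) (negPf hj).
Qed.

HB.instance Definition _ := GRing.Zmodule_isNzRing.Build (tens R S)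
  tmulA tmul1t tmult1 tmulDl tmulDr tone_neq0.

Fact tscalerAl (c : k) (s t : tens R S) : c *: (s * t) = (c *: s) * t.
Proof.
have := tmulPl c s 0 t; rewrite addr0 => E; apply/esym; rewrite [LHS]E.
by rewrite [X in _ + X](mul0r t) addr0.
Qed.
HB.instance Definition _ := GRing.Lmodule_isLalgebra.Build k (tens R S) tscalerAl.
Fact tscalerAr (c : k) (s t : tens R S) : c *: (s * t) = s * (c *: t).
Proof.
have := tmulPr c t 0 s; rewrite addr0 => E; apply/esym; rewrite [LHS]E.
by rewrite [X in _ + X](mulr0 s) addr0.
Qed.
HB.instance Definition _ := GRing.Lalgebra_isAlgebra.Build k (tens R S) tscalerAr.
HB.instance Definition _ := Algebra_isFalgebra.Build k (tens R S).

Lemma tpureM (a c : R) (b d : S) : (a ⊗ b) * (c ⊗ d) = (a * c) ⊗ (b * d).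
Proof. exact: tmulE. Qed.
Lemma tpure11 : (1 : R) ⊗ (1 : S) = 1.
Proof. by []. Qed.
End TensorAlgebra.

Section Characters.
Variables (k : closedFieldType) (aT : finGroupType).

Definition is_char (f : {ffun aT -> k}) : bool :=
  (f 1%g == 1) && [forall a, forall b, f (a * b)%g == f a * f b].

(* Multiplicative functions with values in k; the values are automatically
   nonzero, see char_neq0. *)
Record chargroup : Type := Character {
  char_val :> {ffun aT -> k};
  char_valP : is_char char_val
}.

HB.instance Definition _ := [isSub for char_val].
HB.instance Definition _ := [Choice of chargroup by <:].

Lemma char1 (chi : chargroup) : chi 1%g = 1.
Proof. by case/andP: (char_valP chi) => /eqP. Qed.

Lemma charM (chi : chargroup) a b : chi (a * b)%g = chi a * chi b.
Proof. by case/andP: (char_valP chi) => _ /forallP/(_ a)/forallP/(_ b)/eqP. Qed.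

Lemma charX (chi : chargroup) a n : chi (a ^+ n)%g = chi a ^+ n.
Proof. by elim: n => [|n IH]; rewrite ?char1 // expgS exprS charM IH. Qed.

Lemma char_neq0 (chi : chargroup) a : chi a != 0.
Proof.
apply/eqP=> chi0; have := char1 chi; rewrite -(mulgV a) charM chi0 mul0r.
by move/eqP; rewrite eq_sym oner_eq0.
Qed.

(* The values of a character are roots of 'X^#|A| - 1, which bounds the number
   of characters. *)
Definition char_values : seq k :=
  sval (closed_field_poly_normal ('X^#|aT| - 1 : {poly k})).

Lemma char_in_values (chi : chargroup) a : chi a \in char_values.
Proof.
rewrite /char_values; case: closed_field_poly_normal => s /= ps.
have n0 : (0 < #|aT|)%N by apply/card_gt0P; exists 1%g.
have pm := monicXnsubC (1 : k) n0.
rewrite -root_prod_XsubC -[X in root X]scale1r.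
rewrite -(monicP pm) -ps rootE !hornerE -charX.
have /dvdnP[q ->] : (#[a]%g %| #|aT|)%N by rewrite -cardsT order_dvdG ?inE.
by rewrite mulnC expgM expg_order expg1n char1 subrr.
Qed.

Definition char_code (chi : chargroup) : {ffun aT -> seq_sub char_values} :=
  [ffun a => SeqSub (char_in_values chi a)].

Definition char_decode (f : {ffun aT -> seq_sub char_values}) : option chargroup :=
  insub [ffun a => ssval (f a)].

Lemma char_codeK : pcancel char_code char_decode.
Proof.
move=> chi; rewrite /char_decode (_ : finfun _ = val chi) ?valK //.
by apply/ffunP=> a; rewrite !ffunE.
Qed.

HB.instance Definition _ : isCountable chargroup := PCanIsCountable char_codeK.
HB.instance Definition _ : isFinite chargroup := PCanIsFinite char_codeK.

Fact char_one_subproof : is_char [ffun _ : aT => 1 : k].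
Proof.
by rewrite /is_char ffunE eqxx; apply/forallP=> a; apply/forallP=> b; rewrite !ffunE mul1r.
Qed.
Definition char_one := Character char_one_subproof.

Fact char_mul_subproof (chi psi : chargroup) : is_char [ffun a : aT => chi a * psi a].
Proof.
rewrite /is_char ffunE !char1 mulr1 eqxx; apply/forallP=> a; apply/forallP=> b.
by rewrite !ffunE !charM mulrACA.
Qed.
Definition char_mul chi psi := Character (char_mul_subproof chi psi).

Fact char_inv_subproof (chi : chargroup) : is_char [ffun a : aT => (chi a)^-1].
Proof.
rewrite /is_char ffunE !char1 invr1 eqxx; apply/forallP=> a; apply/forallP=> b.
by rewrite !ffunE !charM invfM.
Qed.
Definition char_inv chi := Character (char_inv_subproof chi).

Fact char_mulA : associative char_mul.
Proof. by move=> x y z; apply/val_inj/ffunP=> a; rewrite !ffunE mulrA. Qed.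
Fact char_mul1 : left_id char_one char_mul.
Proof. by move=> x; apply/val_inj/ffunP=> a; rewrite !ffunE mul1r. Qed.
Fact char_mulV : left_inverse char_one char_inv char_mul.
Proof. by move=> x; apply/val_inj/ffunP=> a; rewrite !ffunE mulVf // char_neq0. Qed.

HB.instance Definition _ :=
  Finite_isGroup.Build chargroup char_mulA char_mul1 char_mulV.

Lemma charMl (chi psi : chargroup) a : (chi * psi)%g a = chi a * psi a.
Proof. by rewrite ffunE. Qed.
Lemma charVl (chi : chargroup) a : (chi^-1)%g a = (chi a)^-1.
Proof. by rewrite ffunE. Qed.

End Characters.

Lemma linfunE (k : fieldType) (U V : vectType k) (f : U -> V) :
  linear f -> linfun f =1 f.
Proof.
move=> lf x; pose m := GRing.isLinear.Build k U V _ f lf.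
by pose L : {linear U -> V} := HB.pack f m; exact: (lfunE L).
Qed.

Section Modules.
Variable k : fieldType.

Record fdmod (R : falgType k) : Type := FdMod {
  fm_sort :> vectType k;
  fm_act : 'Hom(R, 'End(fm_sort));
  fm_act1 : fm_act 1 = \1%VF;
  fm_actM : forall a b, fm_act (a * b) = (fm_act a \o fm_act b)%VF
}.

Definition submodule (R : falgType k) (M : fdmod R) (U : {vspace M}) : Prop :=
  forall a u, u \in U -> fm_act M a u \in U.

Definition irreducible_mod (R : falgType k) (M : fdmod R) : Prop :=
  fullv != 0%VS :> {vspace M} /\
  forall U : {vspace M}, submodule U -> U = 0%VS \/ U = fullv.

Definition completely_reducible (R : falgType k) (M : fdmod R) : Prop :=
  forall U : {vspace M}, submodule U ->
  exists W : {vspace M}, [/\ submodule W, (U + W)%VS = fullv & (U :&: W)%VS = 0%VS].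

Section Constructions.
Variables R S : falgType k.

Fact amull_linear (T : falgType k) : linear (@amull k T).
Proof.
by move=> c x y; apply/lfunP=> z; rewrite add_lfunE scale_lfunE !lfunE /= mulrDl scalerAl.
Qed.

Fact amulr_linear (T : falgType k) : linear (@amulr k T).
Proof.
by move=> c x y; apply/lfunP=> z; rewrite add_lfunE scale_lfunE !lfunE /= mulrDr scalerAr.
Qed.

Fact fdreg_act1 : linfun (@amull k R) 1 = \1%VF.
Proof.
rewrite (linfunE (@amull_linear R)).
by apply/lfunP=> z; rewrite lfunE id_lfunE /= mul1r.
Qed.
Fact fdreg_actM a b :
  linfun (@amull k R) (a * b) = (linfun (@amull k R) a \o linfun (@amull k R) b)%VF.
Proof.
rewrite !(linfunE (@amull_linear R)).
by apply/lfunP=> z; rewrite comp_lfunE !lfunE /= mulrA.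
Qed.
Definition fdreg : fdmod R := FdMod fdreg_act1 fdreg_actM.

(* Restriction of scalars along f. *)
Definition fdpull_act (f : 'AHom(R, S)) (M : fdmod S) : 'Hom(R, 'End(M)) :=
  (fm_act M \o f)%VF.
Fact fdpull_act1 f M : fdpull_act f M 1 = \1%VF.
Proof. by rewrite comp_lfunE rmorph1 fm_act1. Qed.
Fact fdpull_actM f M a b :
  fdpull_act f M (a * b) = (fdpull_act f M a \o fdpull_act f M b)%VF.
Proof. by rewrite !comp_lfunE rmorphM fm_actM. Qed.
Definition fdpull f M : fdmod R := FdMod (fdpull_act1 f M) (@fdpull_actM f M).

(* The outer tensor product, a module over tens R S. *)
Definition fdbox_act (M : fdmod R) (N : fdmod S) : 'Hom(tens R S, 'End(tens M N)) :=
  tlift (fun a b => tmap (fm_act M a) (fm_act N b)).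

Lemma fdbox_actE M N a b : fdbox_act M N (a ⊗ b) = tmap (fm_act M a) (fm_act N b).
Proof.
have [l r] := tmap_bilin M M N N.
by rewrite tliftE //; split=> x c y z; rewrite linearP; first [exact: l | exact: r].
Qed.
Fact fdbox_act1 M N : fdbox_act M N 1 = \1%VF.
Proof. by rewrite -tpure11 fdbox_actE !fm_act1 tmap1. Qed.
Fact fdbox_actM M N s t :
  fdbox_act M N (s * t) = (fdbox_act M N s \o fdbox_act M N t)%VF.
Proof.
elim/tens_ind: s => [a b|c s s' IH IH']; last first.
  rewrite mulrDl linearD -scalerAl linearZ /= IH IH' linearP.
  by rewrite comp_lfunDl -comp_lfunZl.
elim/tens_ind: t => [a' b'|c s s' IH IH']; last first.
  rewrite mulrDr linearD -scalerAr linearZ /= IH IH' linearP.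
  by rewrite comp_lfunDr -comp_lfunZr.
by rewrite tpureM !fdbox_actE tmap_comp !fm_actM.
Qed.
Definition fdbox M N : fdmod (tens R S) := FdMod (fdbox_act1 M N) (@fdbox_actM M N).
Lemma fdboxE M N a b : fm_act (fdbox M N) (a ⊗ b) = tmap (fm_act M a) (fm_act N b).
Proof. exact: fdbox_actE. Qed.

Section Sub.
Variables (M : fdmod R) (U : {vspace M}) (stableU : submodule U).
Definition fdsub_fun (a : R) : 'End(subvs_of U) :=
  (linfun (vsproj U) \o fm_act M a \o linfun vsval)%VF.
Fact fdsub_linear : linear fdsub_fun.
Proof.
move=> c a b; apply/lfunP=> u; rewrite add_lfunE scale_lfunE !comp_lfunE.
by rewrite !lfunE /= linearP add_lfunE scale_lfunE linearP.
Qed.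
Lemma fdsub_funE a u : vsval (linfun fdsub_fun a u) = fm_act M a (vsval u).
Proof.
rewrite (linfunE fdsub_linear) !comp_lfunE !lfunE /= vsprojK //.
exact/stableU/subvsP.
Qed.
Fact fdsub_act1 : linfun fdsub_fun 1 = \1%VF.
Proof. by apply/lfunP=> u; apply: subvs_inj; rewrite fdsub_funE fm_act1 !id_lfunE. Qed.
Fact fdsub_actM a b : linfun fdsub_fun (a * b) = (linfun fdsub_fun a \o linfun fdsub_fun b)%VF.
Proof.
by apply/lfunP=> u; apply: subvs_inj; rewrite comp_lfunE !fdsub_funE fm_actM comp_lfunE.
Qed.
Definition fdsub : fdmod R := FdMod fdsub_act1 fdsub_actM.
End Sub.
End Constructions.

Definition semisimple (R : falgType k) : Prop := completely_reducible (fdreg R).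

Section Scalar.
Variable V : vectType k.
Definition scal_fun (c : k^o) : 'End(V) := (c : k) *: \1%VF.
Fact scal_linear : linear scal_fun.
Proof. by move=> c a b; rewrite /scal_fun scalerDl scalerA. Qed.
Fact fdscal_act1 : linfun scal_fun 1 = \1%VF.
Proof. by rewrite (linfunE scal_linear) /scal_fun scale1r. Qed.
Fact fdscal_actM a b : linfun scal_fun (a * b) = (linfun scal_fun a \o linfun scal_fun b)%VF.
Proof.
by rewrite !(linfunE scal_linear) /scal_fun -comp_lfunZl -comp_lfunZr comp_lfun1l scalerA.
Qed.
Definition fdscal : fdmod k^o := FdMod fdscal_act1 fdscal_actM.
End Scalar.

Section Intertwiners.
Variables V W : vectType k.

Definition commut_fun (r : 'End(V)) (s : 'End(W)) (f : 'Hom(V, W)) : 'Hom(V, W) :=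
  ((f \o r) - (s \o f))%VF.
Definition commuting (r : 'End(V)) (s : 'End(W)) : {vspace 'Hom(V, W)} :=
  lker (linfun (commut_fun r s)).

Lemma mem_commuting r s f : (f \in commuting r s) = ((f \o r)%VF == (s \o f)%VF).
Proof.
rewrite memv_ker linfunE ?subr_eq0 // => c x y; rewrite /commut_fun comp_lfunDl comp_lfunDr.
by rewrite -comp_lfunZl -comp_lfunZr scalerBr opprD addrACA.
Qed.

(* It is enough to test commutation on a basis of I, see intertwinersP. *)
Definition intertwiners (I : vectType k) (r : 'Hom(I, 'End(V))) (s : 'Hom(I, 'End(W))) :
    {vspace 'Hom(V, W)} :=
  (\bigcap_i commuting (r (bv i)) (s (bv i)))%VS.

Lemma intertwinersP (I : vectType k) (r : 'Hom(I, 'End(V))) (s : 'Hom(I, 'End(W))) f :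
  reflect (forall a, (f \o r a)%VF = (s a \o f)%VF) (f \in intertwiners r s).
Proof.
rewrite memvE; apply: (iffP subv_bigcapP) => [h a|h i _]; last first.
  by rewrite -memvE mem_commuting h.
rewrite (bvE a) !linear_sum /=; apply/lfunP=> x; rewrite !comp_lfunE !sum_lfunE linear_sum.
apply: eq_bigr => i _; rewrite !linearZ /= !scale_lfunE linearZ /=; congr (_ *: _).
have := h i isT; rewrite -memvE mem_commuting => /eqP/lfunP/(_ x).
by rewrite !comp_lfunE.
Qed.
End Intertwiners.

Definition fdhoms (R : falgType k) (M N : fdmod R) : {vspace 'Hom(M, N)} :=
  intertwiners (fm_act M) (fm_act N).
End Modules.

Record category : Type := Category {
  obj :> Type;
  hom : obj -> obj -> Type;
  idm : forall X, hom X X;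
  comp : forall X Y Z, hom Y Z -> hom X Y -> hom X Z;
  comp1m : forall X Y (f : hom X Y), comp (idm Y) f = f;
  compm1 : forall X Y (f : hom X Y), comp f (idm X) = f;
  compA : forall X Y Z T (h : hom Z T) (g : hom Y Z) (f : hom X Y),
    comp h (comp g f) = comp (comp h g) f
}.
Arguments hom {c} X Y.
Arguments idm {c} X.
Arguments comp {c X Y Z} g f.
Notation "g ∘ f" := (comp g f) (at level 50, left associativity).

Definition is_iso (C : category) (X Y : C) (f : hom X Y) : Prop :=
  exists g : hom Y X, g ∘ f = idm X /\ f ∘ g = idm Y.

Record functor (C D : category) : Type := Functor {
  fobj :> C -> D;
  fmor : forall X Y, hom X Y -> hom (fobj X) (fobj Y);
  fmor1 : forall X, fmor (idm X) = idm (fobj X);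
  fmorM : forall X Y Z (g : hom Y Z) (f : hom X Y), fmor (g ∘ f) = fmor g ∘ fmor f
}.
Arguments fmor {C D} _ {X Y} f.

(* F has a quasi-inverse G, with natural isomorphisms eta : 1 -> G F and
   theta : F G -> 1. *)
Definition is_equivalence (C D : category) (F : functor C D) : Prop :=
  exists (G : functor D C)
         (eta : forall X : C, hom X (G (F X))) (theta : forall Y : D, hom (F (G Y)) Y),
    [/\ forall X, is_iso (eta X),
        forall X X' (f : hom X X'), eta X' ∘ f = fmor G (fmor F f) ∘ eta X,
        forall Y, is_iso (theta Y) &
        forall Y Y' (g : hom Y Y'), theta Y' ∘ fmor F (fmor G g) = g ∘ theta Y].

(* A category whose morphisms are subspaces of spaces of linear maps. *)
Section LinearCategory.
Variables (k : fieldType) (T : Type) (V : T -> vectType k).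
Variable homs : forall M N : T, {vspace 'Hom(V M, V N)}.
Hypothesis homs1 : forall M, \1%VF \in homs M M.
Hypothesis homsM : forall M N P g f,
  g \in homs N P -> f \in homs M N -> (g \o f)%VF \in homs M P.
Definition linhom M N : Type := subvs_of (homs M N).
Definition linid M : linhom M M := Subvs (homs1 M).
Definition lincomp M N P (g : linhom N P) (f : linhom M N) : linhom M P :=
  Subvs (homsM (subvsP g) (subvsP f)).
Definition lincat : category.
Proof.
refine (@Category T linhom linid lincomp _ _ _).
- by move=> M N f; apply: subvs_inj; rewrite /= comp_lfun1l.
- by move=> M N f; apply: subvs_inj; rewrite /= comp_lfun1r.
- by move=> M N P Q h g f; apply: subvs_inj; rewrite /= comp_lfunA.
Defined.
End LinearCategory.

Section ModuleCategory.
Variables (k : fieldType) (R : falgType k).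
Fact fdhoms1 (M : fdmod R) : \1%VF \in fdhoms M M.
Proof. by apply/intertwinersP=> a; rewrite comp_lfun1l comp_lfun1r. Qed.
Fact fdhomsM (M N P : fdmod R) g f :
  g \in fdhoms N P -> f \in fdhoms M N -> (g \o f)%VF \in fdhoms M P.
Proof.
move=> /intertwinersP gP /intertwinersP fP; apply/intertwinersP=> a.
by rewrite -comp_lfunA fP !comp_lfunA gP.
Qed.
Definition fdmod_cat : category := lincat fdhoms1 fdhomsM.
End ModuleCategory.

Record hopfAlg (k : fieldType) : Type := HopfAlg {
  hopf_sort :> falgType k;
  Delta : 'AHom(hopf_sort, tens hopf_sort hopf_sort);
  eps : 'AHom(hopf_sort, k^o);
  antipode : 'End(hopf_sort);
  coassoc : forall h, tassoc (tmap Delta \1 (Delta h)) = tmap \1 Delta (Delta h);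
  counitl : forall h, tunitl (tmap eps \1 (Delta h)) = h;
  counitr : forall h, tunitr (tmap \1 eps (Delta h)) = h;
  antipodel : forall h, tlift (fun x y => antipode x * y) (Delta h) = (eps h)%:A;
  antipoder : forall h, tlift (fun x y => x * antipode y) (Delta h) = (eps h)%:A
}.

Section HopfModules.
Variables (k : fieldType) (H : hopfAlg k).

(* The tensor product and the unit object of Rep(H) = fdmod_cat H. *)
Definition fdtens (X Y : fdmod H) : fdmod H := fdpull (Delta H) (fdbox X Y).
Definition fdunit : fdmod H := fdpull (eps H) (fdscal k^o).

Definition grouplike (g : H) : Prop := g != 0 /\ Delta H g = g ⊗ g.

(* The data of a module category over Rep(H): a category, the bifunctor
   Rep(H) x C -> C and the components of the associativity and unit
   constraints.  Module functors and their equivalences only refer to these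
   data.  Abelianness, exactness of the action, naturality and
   invertibility of the constraints and the pentagon and triangle identities
   are not recorded: they are theorems about the two module categories catJ and
   catK below, not hypotheses on them. *)
Record modcat_data : Type := ModCat {
  mc_cat :> category;
  mc_act : fdmod H -> mc_cat -> mc_cat;
  mc_actm : forall (X X' : fdmod_cat H) (M M' : mc_cat),
    hom X X' -> hom M M' -> hom (mc_act X M) (mc_act X' M');
  mc_actm1 : forall X M, mc_actm (idm X) (idm M) = idm (mc_act X M);
  mc_actmM : forall (X X' X'' : fdmod_cat H) (M M' M'' : mc_cat)
      (f' : hom X' X'') (f : hom X X') (g' : hom M' M'') (g : hom M M'),
    mc_actm (f' ∘ f) (g' ∘ g) = mc_actm f' g' ∘ mc_actm f g;
  mc_assoc : forall X Y M, hom (mc_act (fdtens X Y) M) (mc_act X (mc_act Y M));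
  mc_unit : forall M, hom (mc_act fdunit M) M
}.
Arguments mc_act {m} X M.
Arguments mc_actm {m X X' M M'} f g.
Arguments mc_assoc {m} X Y M.
Arguments mc_unit {m} M.
Local Notation "X ⊛ M" := (mc_act X M) (at level 38, right associativity).

Record modfunctor (C D : modcat_data) : Type := ModFunctor {
  mf_fun :> functor C D;
  mf_c : forall X M, hom (mf_fun (X ⊛ M)) (X ⊛ mf_fun M);
  mf_c_iso : forall X M, is_iso (mf_c X M);
  mf_c_nat : forall (X X' : fdmod_cat H) (M M' : C) (f : hom X X') (g : hom M M'),
    mf_c X' M' ∘ fmor mf_fun (mc_actm f g) = mc_actm f (fmor mf_fun g) ∘ mf_c X M;
  mf_c_assoc : forall X Y M,
    mc_assoc X Y (mf_fun M) ∘ mf_c (fdtens X Y) M =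
    mc_actm (idm (X : fdmod_cat H)) (mf_c Y M) ∘ mf_c X (Y ⊛ M)
      ∘ fmor mf_fun (mc_assoc X Y M);
  mf_c_unit : forall M,
    mc_unit (mf_fun M) ∘ mf_c fdunit M = fmor mf_fun (mc_unit M)
}.

Record comodAlg : Type := ComodAlg {
  ca_sort :> falgType k;
  coact : 'AHom(ca_sort, tens H ca_sort);
  coactA : forall x, tassoc (tmap (Delta H) \1 (coact x)) = tmap \1 coact (coact x);
  coact1 : forall x, tunitl (tmap (eps H) \1 (coact x)) = x
}.

Section ComoduleAlgebra.
Variable K : comodAlg.

(* The subspace H ⊗ I of H ⊗ K. *)
Definition tens_sub (I : {vspace K}) : {vspace tens H K} :=
  limg (tmap \1 (linfun (@vsval k K I))).

Definition Hsimple : Prop :=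
  forall I : {vspace K}, (fullv * I <= I)%VS -> (I * fullv <= I)%VS ->
    (coact K @: I <= tens_sub I)%VS -> I = 0%VS \/ I = fullv.

Definition coinvariants : {vspace K} :=
  lker ((coact K : 'Hom(K, tens H K)) - linfun (@tpure k H K 1)).

Lemma coinvariantsP x : reflect (coact K x = 1 ⊗ x) (x \in coinvariants).
Proof.
rewrite memv_ker add_lfunE opp_lfunE lfunE /= subr_eq0; exact: eqP.
Qed.

(* X ⊗ M with k . (x ⊗ v) = k_(-1) x ⊗ k_(0) v. *)
Definition caact (X : fdmod H) (M : fdmod K) : fdmod K := fdpull (coact K) (fdbox X M).

End ComoduleAlgebra.
End HopfModules.

Section Homs.
Variable k : fieldType.

Lemma fdhoms_pull (R S : falgType k) (phi : 'AHom(R, S)) (M N : fdmod S) f :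
  f \in fdhoms M N -> f \in fdhoms (fdpull phi M) (fdpull phi N).
Proof. by move/intertwinersP=> h; apply/intertwinersP=> a; rewrite !comp_lfunE h. Qed.

Lemma fdhoms_box (R S : falgType k) (M M' : fdmod R) (N N' : fdmod S) f g :
  f \in fdhoms M M' -> g \in fdhoms N N' ->
  tmap f g \in fdhoms (fdbox M N) (fdbox M' N').
Proof.
move=> /intertwinersP hf /intertwinersP hg; apply/intertwinersP=> t.
elim/tens_ind: t => [a b|c s t IHs IHt].
  by rewrite !fdbox_actE !tmap_comp hf hg.
rewrite !linearP /= comp_lfunDr comp_lfunDl IHt -comp_lfunZr IHs.
by rewrite -comp_lfunZl.
Qed.

Lemma fdbox_assoc (R S T : falgType k) (X : fdmod R) (Y : fdmod S) (M : fdmod T) t :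
  (tassoc \o fm_act (fdbox (fdbox X Y) M) t)%VF =
  (fm_act (fdbox X (fdbox Y M)) (tassoc t) \o tassoc)%VF.
Proof.
elim/tens_ind: t => [s c|c s t IHs IHt]; last first.
  rewrite !linearP /= comp_lfunDr comp_lfunDl IHt -comp_lfunZr IHs.
  by rewrite -comp_lfunZl.
elim/tens_ind: s => [a b|d s t IHs IHt]; last first.
  rewrite tpurePl !linearP /= comp_lfunDr comp_lfunDl IHt -comp_lfunZr IHs.
  by rewrite -comp_lfunZl.
apply: text => xy m; elim/tens_ind: xy => [x y|d s t IHs IHt]; last first.
  by rewrite tpurePl !linearP /= IHs IHt.
by rewrite !comp_lfunE !tassocE !(fdboxE, tmapE) !tassocE.
Qed.
End Homs.

Section MoreHoms.
Variable k : fieldType.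

Lemma fdbox_pullr (R S S' : falgType k) (g : 'AHom(S, S')) (P : fdmod R) (Q : fdmod S') t :
  fm_act (fdbox P (fdpull g Q)) t = fm_act (fdbox P Q) (tmap \1 g t).
Proof.
rewrite -[RHS](@comp_lfunE _ _ _ _ (fdbox_act P Q)); congr (fun_of_lfun _ t).
by apply: text => x y; rewrite comp_lfunE tmapE !fdbox_actE id_lfunE comp_lfunE.
Qed.

Lemma fdbox_pulll (R R' S : falgType k) (g : 'AHom(R, R')) (P : fdmod R') (Q : fdmod S) t :
  fm_act (fdbox (fdpull g P) Q) t = fm_act (fdbox P Q) (tmap g \1 t).
Proof.
rewrite -[RHS](@comp_lfunE _ _ _ _ (fdbox_act P Q)); congr (fun_of_lfun _ t).
by apply: text => x y; rewrite comp_lfunE tmapE !fdbox_actE id_lfunE comp_lfunE.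
Qed.

Lemma fdbox_unit (S : falgType k) (M : fdmod S) t :
  (tunitl \o fm_act (fdbox (fdscal k^o) M) t)%VF = (fm_act M (tunitl t) \o tunitl)%VF.
Proof.
elim/tens_ind: t => [c b|d s t IHs IHt]; last first.
  rewrite !linearP /= comp_lfunDr comp_lfunDl IHt -comp_lfunZr IHs.
  by rewrite -comp_lfunZl.
apply: text => x m; rewrite !comp_lfunE !fdboxE tmapE !tunitlE.
rewrite [fm_act (fdscal _) c](linfunE (@scal_linear k k^o)) scale_lfunE id_lfunE.
by rewrite -scalerA !linearZ /= scale_lfunE linearZ.
Qed.

Variable H : hopfAlg k.

Section CatK.
Variable K : comodAlg H.

Fact catK_actm_subproof (X X' : fdmod H) (M M' : fdmod K)
    (f : subvs_of (fdhoms X X')) (g : subvs_of (fdhoms M M')) :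
  tmap (vsval f) (vsval g) \in fdhoms (caact X M) (caact X' M').
Proof. exact/fdhoms_pull/fdhoms_box/subvsP/subvsP. Qed.

Fact catK_assoc_subproof (X Y : fdmod H) (M : fdmod K) :
  tassoc \in fdhoms (caact (fdtens X Y) M) (caact X (caact Y M)).
Proof.
apply/intertwinersP=> a; rewrite /caact /fdtens !comp_lfunE.
have El := fdbox_pulll (Delta H) (fdbox X Y) M (coact K a).
have Er := fdbox_pullr (coact K) X (fdbox Y M) (coact K a).
apply: etrans (congr1 (comp_lfun tassoc) El) _.
apply: etrans (congr1 (fun z => comp_lfun z tassoc) (esym Er)).
by rewrite -coactA; exact: fdbox_assoc.
Qed.

Fact catK_unit_subproof (M : fdmod K) : tunitl \in fdhoms (caact (fdunit H) M) M.
Proof.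
apply/intertwinersP=> a; rewrite /caact /fdunit !comp_lfunE.
have El := fdbox_pulll (eps H) (fdscal k^o) M (coact K a).
apply: etrans (congr1 (comp_lfun tunitl) El) _.
by rewrite -[X in fm_act M X]coact1; exact: fdbox_unit.
Qed.

Definition catK : modcat_data H.
Proof.
refine (@ModCat k H (fdmod_cat K) (@caact k H K)
  (fun X X' M M' f g => Subvs (catK_actm_subproof f g)) _ _
  (fun X Y M => Subvs (catK_assoc_subproof X Y M))
  (fun M => Subvs (catK_unit_subproof M))).
- by move=> X M; apply: subvs_inj; rewrite /= tmap1.
- by move=> X X' X'' M M' M'' f' f g' g; apply: subvs_inj; rewrite /= tmap_comp.
Defined.
End CatK.
End MoreHoms.

Section Twist.
Variables (k : closedFieldType) (H : hopfAlg k).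

(* A finite abelian subgroup of the group of group-like elements, given as an
   abstract finite group with its embedding into H. *)
Record glsubgroup : Type := GLSubgroup {
  gl_group :> finGroupType;
  gl_emb : gl_group -> H;
  gl_inj : injective gl_emb;
  gl_emb1 : gl_emb 1%g = 1;
  gl_embM : forall a b, gl_emb (a * b)%g = gl_emb a * gl_emb b;
  gl_grouplike : forall a, grouplike (gl_emb a);
  gl_abelian : abelian [set: gl_group]
}.

Variable A : glsubgroup.
Local Notation Ahat := (chargroup k A).
Local Notation "⟦ a ⟧" := (gl_emb a) (at level 0, format "⟦ a ⟧").

(* The idempotent P_mu. *)
Definition charidem (mu : Ahat) : H :=
  #|A|%:R^-1 *: \sum_(a : A) mu (a^-1)%g *: ⟦a⟧.

(* The two sides of twist_cocycle live in (H ⊗ H) ⊗ H and H ⊗ (H ⊗ H), which are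
   identified by tassoc. *)
Record dynamical_twist (J : Ahat -> tens H H) : Prop := DynamicalTwist {
  twist_unit : forall l, J l \is a GRing.unit;
  twist_comm : forall l (a : A), J l * (⟦a⟧ ⊗ ⟦a⟧) = (⟦a⟧ ⊗ ⟦a⟧) * J l;
  twist_cocycle : forall l,
    tassoc (\sum_(mu : Ahat) tmap (Delta H) \1 (J l) * (J (l * mu^-1)%g ⊗ charidem mu)) =
    tmap \1 (Delta H) (J l) * (1 ⊗ J l);
  twist_counitl : forall l, tunitl (tmap (eps H) \1 (J l)) = 1;
  twist_counitr : forall l, tunitr (tmap \1 (eps H) (J l)) = 1
}.

(* Modules over the group algebra k[A], i.e. representations of A. *)
Record Amod : Type := AMod {
  am_sort :> vectType k;
  am_act : A -> 'End(am_sort);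
  am_act1 : am_act 1%g = \1%VF;
  am_actM : forall a b, am_act (a * b)%g = (am_act a \o am_act b)%VF
}.

Definition Ahoms (V W : Amod) : {vspace 'Hom(V, W)} :=
  (\bigcap_(a : A) commuting (am_act V a) (am_act W a))%VS.

Lemma AhomsP (V W : Amod) f :
  reflect (forall a, (f \o am_act V a)%VF = (am_act W a \o f)%VF) (f \in Ahoms V W).
Proof.
rewrite memvE; apply: (iffP subv_bigcapP) => [h a|h a _].
  by have := h a isT; rewrite -memvE mem_commuting => /eqP.
by rewrite -memvE mem_commuting h.
Qed.

Fact Ahoms1 (V : Amod) : \1%VF \in Ahoms V V.
Proof. by apply/AhomsP=> a; rewrite comp_lfun1l comp_lfun1r. Qed.
Fact AhomsM (U V W : Amod) g f :
  g \in Ahoms V W -> f \in Ahoms U V -> (g \o f)%VF \in Ahoms U W.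
Proof.
move=> /AhomsP gP /AhomsP fP; apply/AhomsP=> a.
by rewrite -comp_lfunA fP !comp_lfunA gP.
Qed.
Definition Amod_cat : category := lincat Ahoms1 AhomsM.

(* The one-dimensional module k_mu. *)
Section CharModule.
Variable mu : Ahat.
Definition charmod_act (a : A) : 'End(k^o) := mu a *: \1%VF.
Fact charmod_act1 : charmod_act 1%g = \1%VF.
Proof. by rewrite /charmod_act char1 scale1r. Qed.
Fact charmod_actM a b : charmod_act (a * b)%g = (charmod_act a \o charmod_act b)%VF.
Proof.
by rewrite /charmod_act charM -comp_lfunZl -comp_lfunZr comp_lfun1l scalerA.
Qed.
Definition charmod : Amod := AMod charmod_act1 charmod_actM.
End CharModule.

Section Weights.
Variables (V : Amod) (mu : Ahat).

(* V[mu] *)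
Definition weightspace : {vspace V} :=
  (\bigcap_(a : A) lker (am_act V a - mu a *: \1%VF))%VS.

Lemma weightspaceP v : reflect (forall a, am_act V a v = mu a *: v) (v \in weightspace).
Proof.
have E a : (v \in lker (am_act V a - mu a *: \1%VF)) = (am_act V a v == mu a *: v).
  by rewrite memv_ker !lfun_simp subr_eq0.
rewrite memvE; apply: (iffP subv_bigcapP) => [h a|h a _].
  by have := h a isT; rewrite -memvE E => /eqP.
by rewrite -memvE E h.
Qed.

(* The action of P_mu on V, which is the projection onto V[mu], see weightprojE. *)
Definition weightproj : 'End(V) :=
  #|A|%:R^-1 *: \sum_(a : A) mu (a^-1)%g *: am_act V a.
End Weights.

Lemma sum_char (mu : Ahat) : mu != 1%g -> \sum_(a : A) mu a = 0.
Proof.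
move=> mu1; have [b hb] : exists b, mu b != 1.
  apply/existsP; apply: contraR mu1 => /existsPn h; apply/eqP/val_inj/ffunP=> b.
  by rewrite ffunE; apply/eqP/negPn/h.
have E : mu b * (\sum_(a : A) mu a) = \sum_(a : A) mu a.
  rewrite mulr_sumr [RHS](reindex_inj (mulgI b)); apply: eq_bigr => a _.
  by rewrite charM.
apply/eqP; have /eqP := congr1 (fun z => z - \sum_(a : A) mu a) E.
rewrite subrr -{2}[\sum_a _]mul1r -mulrBl mulf_eq0 subr_eq0 (negPf hb).
by [].
Qed.

Lemma weightprojE (char0 : [pchar k] =i pred0) (V : Amod) (mu nu : Ahat) v :
  v \in weightspace V nu -> weightproj V mu v = if mu == nu then v else 0.
Proof.
move/weightspaceP=> hv; rewrite scale_lfunE sum_lfunE.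
have -> : \sum_(a : A) (mu (a^-1)%g *: am_act V a) v = (\sum_(a : A) (mu^-1 * nu)%g a) *: v.
  rewrite scaler_suml; apply: eq_bigr => a _; rewrite scale_lfunE hv scalerA charMl charVl.
  congr (_ * _ *: _); apply: (mulfI (char_neq0 mu a)); rewrite -charM mulgV char1.
  by rewrite mulfV // char_neq0.
have [<-|ne] := eqVneq.
  rewrite mulVg (eq_bigr (fun=> 1)) => [|a _]; last by rewrite ffunE.
  rewrite sumr_const scalerA mulVf ?scale1r //.
  by rewrite ((pcharf0P _).1 char0) -lt0n; apply/card_gt0P; exists 1%g.
rewrite sum_char ?scale0r ?scaler0 //; apply: contra ne => /eqP h.
by rewrite -[nu]mul1g -(mulgV mu) -mulgA h mulg1.
Qed.

Section ActionOnAmod.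
Variables (X : fdmod H) (V : Amod).
Definition Atens_act (a : A) : 'End(tens X V) := tmap (fm_act X ⟦a⟧) (am_act V a).
Fact Atens_act1 : Atens_act 1%g = \1%VF.
Proof. by rewrite /Atens_act gl_emb1 fm_act1 am_act1 tmap1. Qed.
Fact Atens_actM a b : Atens_act (a * b)%g = (Atens_act a \o Atens_act b)%VF.
Proof. by rewrite /Atens_act gl_embM fm_actM am_actM tmap_comp. Qed.
Definition Atens : Amod := AMod Atens_act1 Atens_actM.
End ActionOnAmod.

Fact catJ_actm_subproof (X X' : fdmod H) (V V' : Amod)
    (f : subvs_of (fdhoms X X')) (g : subvs_of (Ahoms V V')) :
  tmap (vsval f) (vsval g) \in Ahoms (Atens X V) (Atens X' V').
Proof.
apply/AhomsP=> a; rewrite !tmap_comp.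
by have /intertwinersP-> := subvsP f; have /AhomsP-> := subvsP g.
Qed.

Fact catJ_unit_subproof (V : Amod) : tunitl \in Ahoms (Atens (fdunit H) V) V.
Proof.
apply/AhomsP=> a; apply: text => c v; rewrite !comp_lfunE tmapE tunitlE.
have [_ D] := gl_grouplike a.
have e1 : eps H ⟦a⟧ = 1.
  have /(congr1 (fun z => ⟦(a^-1)%g⟧ * z)) := counitl ⟦a⟧.
  rewrite D tmapE tunitlE id_lfunE -scalerAr -gl_embM mulVg gl_emb1.
  by move/(congr1 (eps H)); rewrite linearZ /= rmorph1 => <-; rewrite [RHS]mulr1.
by rewrite comp_lfunE e1 fdscal_act1 id_lfunE tunitlE linearZ.
Qed.

Section CatJ.
Variables (J : Ahat -> tens H H) (twistJ : dynamical_twist J).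

(* On (x ⊗ y) ⊗ v with v of weight l^-1 this is J^{-1}(l) applied to x ⊗ y, then
   rebracketed, see JassocE. *)
Definition Jassoc (X Y : fdmod H) (V : Amod) :
    'Hom(tens (tens X Y) V, tens X (tens Y V)) :=
  (tassoc \o \sum_(l : Ahat) tmap (fm_act (fdbox X Y) (J l)^-1) (weightproj V l^-1%g))%VF.

Fact catJ_assoc_subproof (X Y : fdmod H) (V : Amod) :
  Jassoc X Y V \in Ahoms (Atens (fdtens X Y) V) (Atens X (Atens Y V)).
Proof.
have Aab : abelian [set: A] := gl_abelian A.
have wc l b : (weightproj V l \o am_act V b)%VF = (am_act V b \o weightproj V l)%VF.
  rewrite -comp_lfunZl -comp_lfunZr; congr (_ *: _).
  apply/lfunP=> v; rewrite !comp_lfunE !sum_lfunE linear_sum; apply: eq_bigr => c _.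
  rewrite !scale_lfunE linearZ /= -!comp_lfunE -!am_actM.
  by have /centP/(_ b (in_setT b))-> := subsetP Aab c (in_setT c).
apply/AhomsP=> a; rewrite /Jassoc.
have [_ D] := gl_grouplike a.
have E : (fm_act (fdtens X Y) ⟦a⟧) = fm_act (fdbox X Y) (⟦a⟧ ⊗ ⟦a⟧).
  by rewrite /= comp_lfunE D.
have C l : GRing.comm (J l)^-1 (⟦a⟧ ⊗ ⟦a⟧).
  apply: commr_sym; apply: commrV; apply: commr_sym.
  exact: (twist_comm twistJ).
have -> : am_act (Atens (fdtens X Y) V) a = tmap (fm_act (fdbox X Y) (⟦a⟧ ⊗ ⟦a⟧)) (am_act V a).
  by rewrite /= /Atens_act E.
rewrite -comp_lfunA.
have -> : ((\sum_l tmap (fm_act (fdbox X Y) (J l)^-1) (weightproj V l^-1%g)) \o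
   tmap (fm_act (fdbox X Y) (⟦a⟧ ⊗ ⟦a⟧)) (am_act V a))%VF =
   (tmap (fm_act (fdbox X Y) (⟦a⟧ ⊗ ⟦a⟧)) (am_act V a) \o
    (\sum_l tmap (fm_act (fdbox X Y) (J l)^-1) (weightproj V l^-1%g)))%VF.
  apply/lfunP=> z; rewrite !comp_lfunE !sum_lfunE linear_sum; apply: eq_bigr => l _.
  rewrite /= -[LHS]comp_lfunE -[RHS]comp_lfunE !tmap_comp wc.
  by rewrite -!(@fm_actM _ _ (fdbox X Y)) (C l).
rewrite !comp_lfunA; congr (_ \o _)%VF; apply: text => xy v.
elim/tens_ind: xy => [x y|c s t IHs IHt].
  by rewrite !comp_lfunE !tmapE fdboxE tmapE !tassocE !tmapE.
by rewrite tpurePl !linearP /= IHs IHt.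
Qed.

Definition catJ : modcat_data H.
Proof.
refine (@ModCat k H Amod_cat Atens
  (fun X X' V V' f g => Subvs (catJ_actm_subproof f g)) _ _
  (fun X Y V => Subvs (catJ_assoc_subproof X Y V))
  (fun V => Subvs (catJ_unit_subproof V))).
- by move=> X V; apply: subvs_inj; rewrite /= tmap1.
- by move=> X X' X'' V V' V'' f' f g' g; apply: subvs_inj; rewrite /= tmap_comp.
Defined.

Lemma JassocE (char0 : [pchar k] =i pred0) (X Y : fdmod H) (V : Amod) (l : Ahat) x y v :
  v \in weightspace V l^-1%g ->
  Jassoc X Y V ((x ⊗ y) ⊗ v) = tassoc (fm_act (fdbox X Y) (J l)^-1 (x ⊗ y) ⊗ v).
Proof.
move=> hv; rewrite comp_lfunE sum_lfunE (bigD1 l) //= tmapE.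
rewrite (weightprojE char0 _ hv) eqxx big1 ?addr0 // => m ne.
by rewrite tmapE (weightprojE char0 _ hv) (inj_eq invg_inj) (negPf ne) linear0.
Qed.
End CatJ.
End Twist.

Section Precomposition.
Variables (k : fieldType) (U V W : vectType k).
Definition precomp_fun (g : 'Hom(U, V)) (f : 'Hom(V, W)) : 'Hom(U, W) := (f \o g)%VF.
Definition precomp (g : 'Hom(U, V)) : 'Hom('Hom(V, W), 'Hom(U, W)) :=
  linfun (precomp_fun g).
Lemma precompE g f : precomp g f = (f \o g)%VF.
Proof.
rewrite linfunE // => c x y; rewrite /precomp_fun comp_lfunDl.
by rewrite -comp_lfunZl.
Qed.
Lemma precomp_linear : linear precomp.
Proof.
move=> c x y; apply/lfunP=> f; rewrite add_lfunE scale_lfunE !precompE.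
by rewrite comp_lfunDr -comp_lfunZr.
Qed.
End Precomposition.
Arguments precomp {k U V W} g.

Section TensorRight.
Variables (k : fieldType) (R : falgType k) (M : fdmod R) (U : vectType k).
Definition fdtensr_fun (a : R) : 'End(tens M U) := tmap (fm_act M a) \1%VF.
Fact fdtensr_linear : linear fdtensr_fun.
Proof. by move=> c x y; rewrite /fdtensr_fun linearP (tmap_bilin _ _ _ _).1. Qed.
Fact fdtensr_act1 : linfun fdtensr_fun 1 = \1%VF.
Proof. by rewrite (linfunE fdtensr_linear) /fdtensr_fun fm_act1 tmap1. Qed.
Fact fdtensr_actM a b :
  linfun fdtensr_fun (a * b) = (linfun fdtensr_fun a \o linfun fdtensr_fun b)%VF.
Proof.
by rewrite !(linfunE fdtensr_linear) /fdtensr_fun tmap_comp fm_actM comp_lfun1l.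
Qed.
Definition fdtensr : fdmod R := FdMod fdtensr_act1 fdtensr_actM.
Lemma fdtensrE a : fm_act fdtensr a = tmap (fm_act M a) \1%VF.
Proof. exact: linfunE fdtensr_linear _. Qed.

Lemma tlift_map (V W U1 U2 : vectType k) (b : V -> W -> U1) (f : 'Hom(U1, U2)) s :
  f (tlift b s) = tlift (fun v w => f (b v w)) s.
Proof.
rewrite !lfunE /= /tlift_fun linear_sum; apply: eq_bigr => i _.
by rewrite linear_sum; apply: eq_bigr => j _; rewrite linearZ.
Qed.

Lemma tlift_comb (V W Z : vectType k) (b b1 b2 : V -> W -> Z) c s :
  (forall v w, b v w = c *: b1 v w + b2 v w) ->
  tlift b s = c *: tlift b1 s + tlift b2 s.
Proof.
move=> h; rewrite !lfunE /= /tlift_fun scaler_sumr -big_split; apply: eq_bigr => i _.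
rewrite scaler_sumr -big_split; apply: eq_bigr => j _ /=.
by rewrite h scalerDr !scalerA mulrC.
Qed.

Lemma eq_tlift (V W Z : vectType k) (b b1 : V -> W -> Z) s :
  (forall v w, b v w = b1 v w) -> tlift b s = tlift b1 s.
Proof.
move=> h; rewrite !lfunE /= /tlift_fun; apply: eq_bigr => i _.
by apply: eq_bigr => j _; rewrite h.
Qed.

Lemma tlift_mem (V W Z : vectType k) (b : V -> W -> Z) (Y : {vspace Z}) s :
  (forall v w, b v w \in Y) -> tlift b s \in Y.
Proof.
move=> h; rewrite !lfunE /= /tlift_fun; apply: memv_suml => i _.
by apply: memv_suml => j _; apply: memvZ.
Qed.

(* An element of V ⊗ W is determined by its images under id ⊗ f. *)
Lemma tens_sep (V W Z : vectType k) (I : Type) (f : I -> 'Hom(W, Z)) (s : tens V W) :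
  (forall w, (forall i, f i w = 0) -> w = 0) ->
  (forall i, tmap \1 (f i) s = 0) -> s = 0.
Proof.
move=> fsep fs0; pose r i := \sum_j s i j *: (bv j : W).
have r0 i : r i = 0.
  apply: fsep => a; rewrite [LHS]bvE big1 // => j _.
  have := fs0 a; rewrite {1}(tensE s) linear_sum => /matrixP/(_ i j).
  rewrite summxE (bigD1 i) //= [X in _ + X]big1 ?addr0; last first.
    move=> i' ne; rewrite linear_sum summxE big1 // => j' _.
    by rewrite linearZ /= tmapE !mxE id_lfunE bc_bv eq_sym (negPf ne) mul0r mulr0.
  rewrite linear_sum summxE mxE => E; rewrite (_ : bc j _ = 0) ?scale0r //.
  rewrite -{}E /r linear_sum /bc linear_sum; apply: eq_bigr => j' _.
  by rewrite !linearZ /= tmapE !mxE id_lfunE /bc -/(bc i _) bc_bv eqxx mul1r.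
apply/matrixP=> i j; rewrite mxE.
have := congr1 (bc j) (r0 i); rewrite /bc linear0 /r linear_sum (bigD1 j) //=.
rewrite big1 => [|j' ne]; rewrite linearZ /= -/(bc j _) bc_bv.
  by rewrite eqxx addr0 mulr1.
by rewrite eq_sym (negPf ne) mulr0.
Qed.
End TensorRight.

Section Stabilizer.
Variables (k : fieldType) (H : hopfAlg k).

Definition Hdual : vectType k := 'Hom(H, k^o).

(* The product of H^*: <g x, h> = <g, h_(1)> <x, h_(2)>. *)
Definition conv_fun (g x : Hdual) : Hdual :=
  (tlift (fun a b : H => (g a : k^o) * x b) \o Delta H)%VF.

Lemma conv_bl (g x : Hdual) : bilin (fun a b : H => (g a : k^o) * x b).
Proof.
split=> z c u v; rewrite linearP.
- by rewrite mulrDl -scalerAl.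
- by rewrite mulrDr -scalerAr.
Qed.

Lemma conv_bilin : bilin conv_fun.
Proof.
split=> z c u v; apply/lfunP=> h;
  rewrite add_lfunE scale_lfunE !comp_lfunE -scale_lfunE -add_lfunE;
  congr (fun_of_lfun _ _); apply: text => a b;
  rewrite add_lfunE scale_lfunE !tliftE; try exact: conv_bl.
- by rewrite add_lfunE scale_lfunE mulrDl scalerAl.
- by rewrite add_lfunE scale_lfunE mulrDr scalerAr.
Qed.

(* (h . f)(t) = f (t h) *)
Definition rtrans (h : H) : 'End(Hdual) := precomp (amulr h).

Lemma rtransE h f t : rtrans h f t = f (t * h).
Proof. by rewrite precompE comp_lfunE lfunE. Qed.

Fact rtrans_linear : linear rtrans.
Proof. by move=> c x y; rewrite /rtrans amulr_linear precomp_linear. Qed.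

Fact fddual_act1 : linfun rtrans 1 = \1%VF.
Proof.
rewrite (linfunE rtrans_linear); apply/lfunP=> f; apply/lfunP=> t.
by rewrite rtransE id_lfunE mulr1.
Qed.
Fact fddual_actM a b : linfun rtrans (a * b) = (linfun rtrans a \o linfun rtrans b)%VF.
Proof.
rewrite !(linfunE rtrans_linear); apply/lfunP=> f; apply/lfunP=> t.
by rewrite comp_lfunE !rtransE mulrA.
Qed.
Definition fddual : fdmod H := FdMod fddual_act1 fddual_actM.

(* <h ⇁ g, t> = <g, S^{-1}(h) t>.  The antipode of a finite-dimensional Hopf
   algebra is bijective, so that the linear pseudo-inverse of antipode is S^{-1}. *)
Definition harpoon (h : H) : 'End(Hdual) := precomp (amull ((antipode H)^-1%VF h)).

Lemma harpoonE h g t : harpoon h g t = g ((antipode H)^-1%VF h * t).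
Proof. by rewrite precompE comp_lfunE lfunE. Qed.

Variable K : comodAlg H.

(* The action of K on H^* ⊗ V: k . (g ⊗ v) = (k_(-1) ⇁ g) ⊗ k_(0) v. *)
Definition dualact (V : fdmod K) : 'Hom(K, 'End(tens Hdual V)) :=
  (tlift (fun h x => tmap (harpoon h) (fm_act V x)) \o coact K)%VF.

Section Pair.
Variables V W : fdmod K.

Definition stabL : 'Hom(tens Hdual 'Hom(V, W), 'Hom(tens Hdual V, tens Hdual W)) :=
  tlift (fun g (T : 'Hom(V, W)) => tlift (fun x v => conv_fun g x ⊗ T v)).

Definition Stab : {vspace 'Hom(tens Hdual V, tens Hdual W)} :=
  (intertwiners (dualact V) (dualact W) :&: limg stabL)%VS.

Lemma stabLE g (T : 'Hom(V, W)) x v : stabL (g ⊗ T) (x ⊗ v) = conv_fun g x ⊗ T v.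
Proof.
have bl g' (T' : 'Hom(V, W)) : bilin (fun x v => conv_fun g' x ⊗ T' v).
  by split=> z c u t; rewrite (linearP, conv_bilin.2) (tpurePl, tpurePr).
rewrite tliftE ?tliftE //; split=> z c u t; apply: text => x' v';
  rewrite add_lfunE scale_lfunE !tliftE //.
- by rewrite (conv_bilin.1 x' c u t) tpurePl.
- by rewrite add_lfunE scale_lfunE tpurePr.
Qed.

(* H^* ⊗ Hom(V, W) seen as a space of functions H -> Hom(V, W). *)
Definition tens_eval (G : tens Hdual 'Hom(V, W)) (t : H) : 'Hom(V, W) :=
  tlift (fun (g : Hdual) (T : 'Hom(V, W)) => (g t : k) *: T) G.

Definition stab_ambient : fdmod H := fdtensr fddual 'Hom(V, W).

Lemma stab_ambientE h (G : stab_ambient) t :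
  tens_eval (fm_act stab_ambient h G) t = tens_eval G (t * h).
Proof.
have bl s : bilin (fun (g : Hdual) (T : 'Hom(V, W)) => (g s : k) *: T).
  split=> c x y z; last by rewrite scalerDr !scalerA mulrC.
  by rewrite add_lfunE scale_lfunE scalerDl scalerA.
rewrite /tens_eval fdtensrE -[LHS]comp_lfunE; congr (fun_of_lfun _ G).
apply: text => g T; rewrite comp_lfunE tmapE !tliftE // id_lfunE.
by rewrite [fm_act _ _](linfunE rtrans_linear) rtransE.
Qed.

Lemma stabL_inj : lker stabL == 0%VS.
Proof.
apply/eqP/vspaceP=> G; rewrite memv_ker memv0; apply/eqP/eqP=> [LG0|->]; last exact: linear0.
pose e : Hdual := eps H.
have conv_eps g : conv_fun g e = g.
  apply/lfunP=> t; rewrite comp_lfunE -[in RHS](counitr t).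
  move: (Delta H t) => s; rewrite -[RHS]comp_lfunE -[RHS]comp_lfunE; congr (fun_of_lfun _ s).
  apply: text => a b; rewrite !comp_lfunE tmapE id_lfunE tunitrE linearZ /=.
  by rewrite tliftE; [exact: mulrC | exact: conv_bl].
pose ev v := linfun (fun T : 'Hom(V, W) => T v).
have evE v T : ev v T = T v.
  by rewrite linfunE // => c x y; rewrite add_lfunE scale_lfunE.
apply: (tens_sep (f := ev)) => [T h|v]; first by apply/lfunP=> v; rewrite -evE h zero_lfunE.
have /lfunP/(_ (e ⊗ v)) := LG0; rewrite zero_lfunE => <-.
elim/tens_ind: G {LG0} => [g T|c s t IHs IHt].
  by rewrite tmapE stabLE conv_eps id_lfunE evE.
by rewrite !linearP /= IHs IHt add_lfunE scale_lfunE.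
Qed.

Lemma antipode_cancel (h : H) :
  tlift (fun a b => Delta H a * (1 ⊗ antipode H b)) (Delta H h) = h ⊗ 1.
Proof.
have bS : bilin (fun a b : H => a * antipode H b).
  by split=> c x y z; rewrite ?linearP ?mulrDl ?mulrDr -?scalerAl -?scalerAr.
pose Psi := tmap (\1%VF : 'End(H)) (tlift (fun a b : H => a * antipode H b)).
have bD : bilin (fun a b : H => Delta H a * (1 ⊗ antipode H b)).
  split=> c x y z; rewrite !linearP; first by rewrite mulrDl -scalerAl.
  by rewrite mulrDr -scalerAr.
have -> : tlift (fun a b => Delta H a * (1 ⊗ antipode H b)) (Delta H h) =
          Psi (tassoc (tmap (Delta H) \1 (Delta H h))).
  suff -> : tlift (fun a b => Delta H a * (1 ⊗ antipode H b)) =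
            (Psi \o tassoc \o tmap (Delta H) \1)%VF by rewrite !comp_lfunE.
  apply: text => a b; rewrite !comp_lfunE tliftE // tmapE id_lfunE.
  elim/tens_ind: (Delta H a) => [c d|c u v IHu IHv].
    by rewrite tpureM mulr1 tassocE tmapE tliftE // id_lfunE.
  by rewrite tpurePl !linearP /= -IHu -IHv mulrDl -scalerAl.
rewrite coassoc -[h in RHS]counitr.
pose q := tmap (\1%VF : 'End(H)) (linfun (fun a : H => (eps H a)%:A : H)).
have -> : Psi (tmap \1%VF (Delta H) (Delta H h)) = q (Delta H h).
  rewrite -[LHS]comp_lfunE tmap_comp comp_lfun1l; congr (tmap _ _ _).
  apply/lfunP=> x; rewrite comp_lfunE antipoder linfunE // => c y z.
  by rewrite linearP scalerDl scalerA.
move: (Delta H h) => s; rewrite -[RHS]/(tpurer 1 _).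
elim/tens_ind: s => [a b|c u v IHu IHv]; last by rewrite !linearP /= IHu IHv.
rewrite !tmapE tunitrE id_lfunE linfunE => [|c y z]; last first.
  by rewrite linearP scalerDl scalerA.
by rewrite /tpurer tpureZl tpureZr.
Qed.

Lemma conv_rtrans (h : H) (g x : Hdual) :
  conv_fun (rtrans h g) x =
  tlift (fun a b => rtrans a (conv_fun g (rtrans (antipode H b) x))) (Delta H h).
Proof.
apply/lfunP=> t; pose B := tlift (fun a b : H => (g a : k^o) * x b).
have BE (c d : H) (s : tens H H) (g' x' : Hdual) :
    (forall a, g' a = g (a * c)) -> (forall a, x' a = x (a * d)) ->
    tlift (fun a b : H => (g' a : k^o) * x' b) s = B (s * (c ⊗ d)).
  move=> hg hx; elim/tens_ind: s => [a b|e s s' IH IH'].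
    rewrite tpureM /B !tliftE; first by rewrite hg hx.
      exact: conv_bl.
    exact: conv_bl.
  by rewrite linearP /= IH IH' mulrDl -scalerAl linearP.
rewrite comp_lfunE (BE h 1) => [|a|a]; rewrite ?rtransE ?mulr1 //.
pose evt := linfun (fun f : Hdual => f t).
have evtE f : evt f = f t.
  by rewrite linfunE // => c y z; rewrite add_lfunE scale_lfunE.
rewrite -[RHS]evtE [RHS]tlift_map -antipode_cancel.
pose mt := linfun (fun s : tens H H => Delta H t * s).
have mtE s : mt s = Delta H t * s.
  by rewrite linfunE // => c y z; rewrite mulrDr -scalerAr.
rewrite -mtE -[LHS]comp_lfunE [LHS]tlift_map; apply: eq_tlift => a b.
rewrite comp_lfunE mtE mulrA -rmorphM evtE rtransE.
by rewrite comp_lfunE [RHS](BE 1 (antipode H b)) // => c; rewrite ?mulr1 ?rtransE.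
Qed.

Lemma stabL_act (h : H) G :
  stabL (fm_act stab_ambient h G) =
  tlift (fun a b => tmap (rtrans a) \1 \o stabL G \o tmap (rtrans (antipode H b)) \1)%VF
    (Delta H h).
Proof.
rewrite fdtensrE; apply: text => x v.
pose ev := linfun (fun f : 'Hom(tens Hdual V, tens Hdual W) => f (x ⊗ v)).
have evE f : ev f = f (x ⊗ v).
  by rewrite linfunE // => c y z; rewrite add_lfunE scale_lfunE.
elim/tens_ind: G => [g T|c G G' IH IH']; last first.
  rewrite !linearP /= add_lfunE scale_lfunE IH IH'.
  rewrite -scale_lfunE -add_lfunE; congr (fun_of_lfun _ _).
  apply/esym; apply: tlift_comb => a b.
  by rewrite comp_lfunDr comp_lfunDl -comp_lfunZr -comp_lfunZl.
rewrite -[RHS]evE [RHS]tlift_map.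
rewrite tmapE stabLE [fm_act _ _](linfunE rtrans_linear) conv_rtrans id_lfunE.
pose pr := linfun (tpurer (T v) : Hdual -> tens Hdual W).
have prE f : pr f = f ⊗ T v by rewrite lfunE.
rewrite -prE [LHS]tlift_map; apply: eq_tlift => a b.
by rewrite evE prE !comp_lfunE !tmapE stabLE tmapE !id_lfunE.
Qed.

Lemma Stab_submodule : submodule (M := stab_ambient) (stabL @^-1: Stab)%VS.
Proof.
have comm (Z : fdmod K) (h : H) a :
    (tmap (rtrans h) \1 \o dualact Z a = dualact Z a \o tmap (rtrans h) \1)%VF.
  rewrite /dualact comp_lfunE; elim/tens_ind: (coact K a) => [b c|c s t IH IH']; last first.
    rewrite !linearP /= comp_lfunDr comp_lfunDl IH' -comp_lfunZr IH.
    by rewrite -comp_lfunZl.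
  rewrite tliftE ?tmap_comp ?comp_lfun1l ?comp_lfun1r; last first.
    split=> d x y z.
      by rewrite /harpoon linearP amull_linear precomp_linear (tmap_bilin _ _ _ _).1.
    by rewrite linearP (tmap_bilin _ _ _ _).2.
  congr (tmap _ _); apply/lfunP=> f; apply/lfunP=> t.
  by rewrite !comp_lfunE rtransE !harpoonE rtransE mulrA.
move=> h G; rewrite -!memv_preim !memv_cap => /andP[/intertwinersP hG _].
rewrite memv_img ?memvf // andbT stabL_act.
apply: tlift_mem => a b; apply/intertwinersP=> c.
by rewrite -!comp_lfunA comm (comp_lfunA (stabL G)) hG !comp_lfunA comm.
Qed.

(* Stab_K(V, W) with the H-action (h . G)(t) = G (t h): as stabL is injective, Stab
   is identified with its preimage in H^* ⊗ Hom(V, W). *)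
Definition Stab_mod : fdmod H := fdsub Stab_submodule.
End Pair.
End Stabilizer.

Section DynamicalDatum.
Variables (k : closedFieldType) (H : hopfAlg k) (A : glsubgroup H).

Section CharSpace.
Variable mu : chargroup k A.

Definition Cspace : {vspace Hdual H} :=
  (\bigcap_(a : A) lker (precomp (amull (gl_emb a)) - mu a *: \1%VF))%VS.

Lemma CspaceP (f : Hdual H) :
  reflect (forall (a : A) h, f (gl_emb a * h) = mu a * f h) (f \in Cspace).
Proof.
have E a : reflect (forall h, f (gl_emb a * h) = mu a * f h)
                   (f \in lker (precomp (amull (gl_emb a)) - mu a *: \1%VF)%VF).
  rewrite memv_ker !lfun_simp precompE subr_eq0.
  apply: (iffP eqP) => [/lfunP h x|h]; last apply/lfunP=> x.
    by have := h x; rewrite comp_lfunE lfunE scale_lfunE.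
  by rewrite comp_lfunE lfunE scale_lfunE /= h.
rewrite memvE; apply: (iffP subv_bigcapP) => [h a|h a _].
  by apply/E; rewrite memvE; exact: h.
by rewrite -memvE; apply/E.
Qed.

Lemma Cspace_submodule : submodule (M := fddual H) Cspace.
Proof.
move=> h f /CspaceP fC; apply/CspaceP=> a t.
by rewrite [fm_act _ _](linfunE (@rtrans_linear _ H)) !rtransE -mulrA fC.
Qed.

Definition Cmod : fdmod H := fdsub Cspace_submodule.
End CharSpace.

Record dynamical_datum (K : comodAlg H) (V : chargroup k A -> fdmod K) : Prop :=
  DynamicalDatum {
    dd_simple : Hsimple K;
    dd_semisimple : semisimple K;
    dd_coinv : coinvariants K = 1%VS;
    dd_irr : forall l, irreducible_mod (V l);
    dd_stab : forall l m,
      exists f : hom (Stab_mod (V l) (V m) : fdmod_cat H) (Cmod (l * m^-1)%g), is_iso f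
  }.
End DynamicalDatum.

(* Main.v *)
Require Import Defs.
From mathcomp Require Import all_boot all_fingroup all_algebra all_solvable all_field.

Set Implicit Arguments.
Unset Strict Implicit.
Unset Printing Implicit Defensive.

Import GRing.Theory.
Local Open Scope ring_scope.
(* vector.v exports another hom; here hom is that of categories. *)
Import Defs.

(** The assertions about the modules V_l = F (k_(l^-1)) are categorical, so that they
    can be read off in the category of A-modules and carried along F.

    Semisimplicity and irreducibility.  By averaging over A, every morphism f of
    A-modules has a morphism r with f r f = f (Amod_vnregular).  This property only
    mentions composition, hence passes through equivalences (equiv_vnregular); applied
    to the inclusion of a submodule it makes the submodule the image of an idempotent,
    whose kernel is a complement.  A module is then irreducible as soon as 0 and 1
    are its only idempotent endomorphisms and differ; these are counted for the
    one-dimensional module k_(l^-1), whose endomorphisms are scalars.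

    Stabilizers.  In a module category the internal Hom from M to N is the object R of
    Rep(H) that represents X |-> Hom (X ⊗ M, N).  It is unique up to isomorphism
    (internal_hom_unique), and an equivalence of module categories preserves it, because
    its structure isomorphisms F (X ⊗ M) -> X ⊗ F M are natural in X
    (internal_hom_equiv).  So it suffices to identify two internal Homs.
    - From k_(l^-1) to k_(m^-1) it is C(l m^-1): this is Frobenius reciprocity, C(mu)
      being the H-module coinduced from the character mu of A (charmod_internal_hom).
    - From V to W, for K-modules V and W, it is Stab_K(V, W) (Stab_internal_hom).  A
      K-linear phi : X ⊗ V -> W corresponds to the map sending x to the function
      G(t) = (v |-> phi (t x ⊗ v)).  Linearity of phi says that
      G(t) a = a_(0) G(S^-1(a_(-1)) t) for a in K, and these equations define the
      stabilizer (Stab_twisted_linear).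

    The last point calculates with S^-1 and so needs the antipode S to be bijective.
    By finiteness of the dimension it is enough that S is injective, and this is proved
    with a nonzero left integral L of H: one has L_1 ⊗ h L_2 = S(h) L_1 ⊗ L_2, so that
    S(h) = 0 gives L_1 ⊗ h y L_2 = 0 for all y and, replacing y by S(L_2),
    L ⊗ h = L_1 ⊗ h S(L_2) L_3 = 0 (antipode_inj).  The integral comes from the
    invariant element of H ⊗ X given by the dual bases, where X is the left dual of the
    regular module: as an H-module, H ⊗ X is a multiple of H (coev_integralP). *)

(** * Multilinear expressions *)

Section Lin.
Variable k : fieldType.
(** A named form of linearity: a head constant that the tactic below can recognize,
    whereas linear f unfolds to a product. *)
Definition lin (U V : lmodType k) (f : U -> V) : Prop := linear f.

Lemma lin_id (U : lmodType k) : lin (fun x : U => x).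
Proof. by []. Qed.
Lemma lin_app (U : lmodType k) (V W : vectType k) (g : 'Hom(V, W)) (f : U -> V) :
  lin f -> lin (fun x => g (f x)).
Proof. by move=> lf c x y; rewrite lf linearP. Qed.
Lemma lin_lapp (U : lmodType k) (V W : vectType k) (f : U -> 'Hom(V, W)) v :
  lin f -> lin (fun x => f x v).
Proof. by move=> lf c x y; rewrite lf add_lfunE scale_lfunE. Qed.
Lemma lin_compl (U : lmodType k) (V W X : vectType k) (f : U -> 'Hom(W, X)) (g : 'Hom(V, W)) :
  lin f -> lin (fun x => f x \o g)%VF.
Proof. by move=> lf c x y; rewrite lf comp_lfunDl comp_lfunZl. Qed.
Lemma lin_mull (U : lmodType k) (R : algType k) (f : U -> R) a :
  lin f -> lin (fun x => f x * a).
Proof. by move=> lf c x y; rewrite lf mulrDl scalerAl. Qed.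
Lemma lin_mulr (U : lmodType k) (R : algType k) (f : U -> R) a :
  lin f -> lin (fun x => a * f x).
Proof. by move=> lf c x y; rewrite lf mulrDr scalerAr. Qed.
Lemma lin_scalel (U V : lmodType k) (f : U -> k^o) (v : V) :
  lin f -> lin (fun x => (f x : k) *: v).
Proof. by move=> lf c x y; rewrite lf scalerDl scalerA. Qed.
Lemma lin_scaler (U V : lmodType k) (f : U -> V) (a : k) :
  lin f -> lin (fun x => a *: f x).
Proof. by move=> lf c x y; rewrite lf scalerDr !scalerA mulrC. Qed.
Lemma lin_tpurel (U : lmodType k) (V W : vectType k) (f : U -> V) (w : W) :
  lin f -> lin (fun x => f x ⊗ w).
Proof. by move=> lf c x y; rewrite lf tpurePl. Qed.
Lemma lin_tpurer (U : lmodType k) (V W : vectType k) (f : U -> W) (v : V) :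
  lin f -> lin (fun x => v ⊗ f x).
Proof. by move=> lf c x y; rewrite lf tpurePr. Qed.
Lemma lin_tlift (U : lmodType k) (V W X : vectType k) (b : V -> W -> X) (f : U -> tens V W) :
  lin f -> lin (fun x => tlift b (f x)).
Proof. exact: lin_app. Qed.
Lemma lin_tliftb (U : lmodType k) (V W X : vectType k) (b : U -> V -> W -> X) t :
  (forall v w, lin (fun x => b x v w)) -> lin (fun x => tlift (b x) t).
Proof. by move=> lb c x y; apply: tlift_comb => v w; apply: lb. Qed.
Lemma lin_bilinl (U : lmodType k) (V W X : vectType k) (b : V -> W -> X) (f : U -> V) w :
  bilin b -> lin f -> lin (fun x => b (f x) w).
Proof. by case=> bl _ lf c x y; rewrite lf bl. Qed.
Lemma lin_bilinr (U : lmodType k) (V W X : vectType k) (b : V -> W -> X) (f : U -> W) v :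
  bilin b -> lin f -> lin (fun x => b v (f x)).
Proof. by case=> _ br lf c x y; rewrite lf br. Qed.
End Lin.

(** Proves linearity, bilinearity or trilinearity of an expression in which each
    variable occurs once, by descending along its occurrence. *)
Ltac multilin :=
  lazymatch goal with
  | |- bilin _ => split; multilin
  | |- forall _, _ => intro; multilin
  | |- linear ?f => change (lin f); multilin
  | |- lin _ => cbv beta;
  first [ exact: lin_id |
  match goal with
  | h : bilin ?b |- lin (fun x => ?b (@?f x) ?a) =>
      apply: (@lin_bilinl _ _ _ _ _ b f a h); multilin
  | h : bilin ?b |- lin (fun x => ?b ?a (@?f x)) =>
      apply: (@lin_bilinr _ _ _ _ _ b f a h); multilin
  | |- lin (fun x => @fun_of_lfun _ _ _ (tlift ?b) (@?f x)) =>
      apply: (@lin_tlift _ _ _ _ _ b f); multilin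
  | |- lin (fun x => @fun_of_lfun _ _ _ (tlift (@?b x)) ?t) =>
      apply: (@lin_tliftb _ _ _ _ _ b t); do 2 intro; multilin
  | |- lin (fun x => @fun_of_lfun _ _ _ ?g (@?f x)) => apply: (@lin_app _ _ _ _ g f); multilin
  | |- lin (fun x => @fun_of_lfun _ _ _ (@?f x) ?v) => apply: (@lin_lapp _ _ _ _ f v); multilin
  | |- lin (fun x => ?a * @?f x) => apply: (@lin_mulr _ _ _ f a); multilin
  | |- lin (fun x => @?f x * ?a) => apply: (@lin_mull _ _ _ f a); multilin
  | |- lin (fun x => ?a *: @?f x) => apply: (@lin_scaler _ _ _ f a); multilin
  | |- lin (fun x => @?f x *: ?a) => apply: (@lin_scalel _ _ _ f a); multilin
  | |- lin (fun x => ?a ⊗ @?f x) => apply: (@lin_tpurer _ _ _ _ f a); multilin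
  | |- lin (fun x => @?f x ⊗ ?a) => apply: (@lin_tpurel _ _ _ _ f a); multilin
  | |- lin (fun x => (@?f x \o ?a)%VF) => apply: (@lin_compl _ _ _ _ _ f a); multilin
  end
  | done | apply: linearP ]
  end.

Section Multilinear.
Variable k : fieldType.
Implicit Types U V W X : vectType k.

Definition trilin U V W X (b : U -> V -> W -> X) : Prop :=
  [/\ forall v w, lin (fun u => b u v w), forall u w, lin (fun v => b u v w)
    & forall u v, lin (fun w => b u v w)].

Lemma tlift_sum U V X (b : U -> V -> X) t :
  tlift b t = \sum_i \sum_j t i j *: b (bv i) (bv j).
Proof. by rewrite lfunE. Qed.

(** Two contractions along independent tensors commute even if F is not multilinear,
    since tlift is defined as a double sum. *)
Lemma tlift_exchange U V W X (Y : vectType k) (F : U -> V -> W -> X -> Y) s t :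
  tlift (fun a b => tlift (fun c d => F a b c d) t) s =
  tlift (fun c d => tlift (fun a b => F a b c d) s) t.
Proof.
rewrite !tlift_sum.
under eq_bigr => i _ do under eq_bigr => j _ do rewrite tlift_sum pair_big scaler_sumr.
under [RHS]eq_bigr => i _ do under eq_bigr => j _ do
  rewrite tlift_sum pair_big scaler_sumr.
rewrite pair_big [RHS]pair_big exchange_big; apply: eq_bigr => p _; apply: eq_bigr => q _ /=.
by rewrite !scalerA mulrC.
Qed.

Lemma tlift_tmap U U' V V' X (f : 'Hom(U, U')) (g : 'Hom(V, V')) (b : U' -> V' -> X) s :
  bilin b -> tlift b (tmap f g s) = tlift (fun u v => b (f u) (g v)) s.
Proof.
move=> bl; rewrite -[LHS]comp_lfunE; congr (fun_of_lfun _ s); apply: text => u v.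
rewrite comp_lfunE tmapE !tliftE //; case: bl => bl br.
by split=> w c x y; rewrite linearP ?bl ?br.
Qed.

Lemma tlift_tassoc U V W X (b : U -> V -> W -> X) s : trilin b ->
  tlift (fun u t => tlift (fun v w => b u v w) t) (tassoc s) =
  tlift (fun t w => tlift (fun u v => b u v w) t) s.
Proof.
case=> b1 b2 b3; rewrite -[LHS]comp_lfunE; congr (fun_of_lfun _ s).
apply: text => t w; rewrite comp_lfunE.
have bl1 : bilin (fun (t : tens U V) w => tlift (fun u v => b u v w) t) by multilin.
have bl2 : bilin (fun u (t : tens V W) => tlift (fun v w => b u v w) t) by multilin.
have bl3 x : bilin (fun u v => b u v x) by multilin.
have bl4 x : bilin (fun v w => b x v w) by multilin.
rewrite [RHS]tliftE //; elim/tens_ind: t => [u v|c s' t IHs IHt].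
  by rewrite tassocE !tliftE.
by rewrite tpurePl !linearP /= IHs IHt.
Qed.
End Multilinear.

Lemma tlift_mul (k : fieldType) (R T : falgType k) (X : vectType k)
    (b : R -> T -> X) (s t : tens R T) : bilin b ->
  tlift b (s * t) = tlift (fun x y => tlift (fun u v => b (x * u) (y * v)) t) s.
Proof.
move=> bl.
have bl1 (t' : tens R T) :
    bilin (fun p q => tlift (fun u v => b (p * u) (q * v)) t') by multilin.
have bl2 p q : bilin (fun u v => b (p * u) (q * v)) by multilin.
elim/tens_ind: s => [p q|c s s' IHs IHt]; last first.
  by rewrite mulrDl -scalerAl !linearP /= IHs IHt.
rewrite [RHS]tliftE //.
elim/tens_ind: t => [u v|c t t' IHs IHt]; last first.
  by rewrite mulrDr -scalerAr !linearP /= IHs IHt.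
by rewrite tpureM !tliftE.
Qed.

Lemma tlift_app (k : fieldType) (U V W X : vectType k) (b : U -> V -> 'Hom(W, X)) t w :
  tlift b t w = tlift (fun u v => b u v w) t.
Proof.
rewrite !tlift_sum sum_lfunE; apply: eq_bigr => i _; rewrite sum_lfunE.
by apply: eq_bigr => j _; rewrite scale_lfunE.
Qed.

Section TensorMore.
Variable k : fieldType.
Implicit Types U V W X : vectType k.

Lemma tlift_pure U V (t : tens U V) : tlift (@tpure k U V) t = t.
Proof. by rewrite tlift_sum -tensE. Qed.

Lemma tlift_tlift U V U' V' X (B : U' -> V' -> X) (f : U -> U') (g : V -> V') t :
  bilin B -> tlift B (tlift (fun u v => f u ⊗ g v) t) = tlift (fun u v => B (f u) (g v)) t.
Proof. by move=> bl; rewrite tlift_map; apply: eq_tlift => u v; rewrite tliftE. Qed.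

Lemma tlift_bigsum U V X (I : finType) (b : I -> U -> V -> X) t :
  tlift (fun u v => \sum_i b i u v) t = \sum_i tlift (b i) t.
Proof.
under [RHS]eq_bigr => i _ do rewrite tlift_sum.
rewrite exchange_big tlift_sum; apply: eq_bigr => i _.
by rewrite exchange_big; apply: eq_bigr => j _; rewrite scaler_sumr.
Qed.

Lemma mulr_tliftr U V (R : falgType k) (a : R) (b : U -> V -> R) t :
  a * tlift b t = tlift (fun u v => a * b u v) t.
Proof.
rewrite !tlift_sum mulr_sumr; apply: eq_bigr => i _; rewrite mulr_sumr.
by apply: eq_bigr => j _; rewrite scalerAr.
Qed.

Lemma mulr_tliftl U V (R : falgType k) (a : R) (b : U -> V -> R) t :
  tlift b t * a = tlift (fun u v => b u v * a) t.
Proof.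
rewrite !tlift_sum mulr_suml; apply: eq_bigr => i _; rewrite mulr_suml.
by apply: eq_bigr => j _; rewrite scalerAl.
Qed.

Lemma scaler_tlift U V X (c : k) (b : U -> V -> X) t :
  c *: tlift b t = tlift (fun u v => c *: b u v) t.
Proof.
rewrite !tlift_sum scaler_sumr; apply: eq_bigr => i _; rewrite scaler_sumr.
by apply: eq_bigr => j _; rewrite !scalerA mulrC.
Qed.

Lemma tpure_eq0l U V (u : U) (v : V) : u ⊗ v = 0 -> v != 0 -> u = 0.
Proof.
move=> uv0 v0; have [i vi] : exists i, bc i v != 0.
  apply/existsP; apply: contraR v0 => /existsPn h; apply/eqP.
  by rewrite [v]bvE big1 // => i _; have /negPn/eqP-> := h i; rewrite scale0r.
rewrite [u]bvE big1 // => j _; have /matrixP/(_ j i)/eqP := uv0.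
by rewrite !mxE mulf_eq0 (negPf vi) orbF => /eqP->; rewrite scale0r.
Qed.

Definition dualbasis V (i : 'I_(\dim {:V})) : 'Hom(V, k^o) :=
  linfun (fun v : V => bc i v : k^o).

(** The element that corresponds to the identity of V under V ⊗ V^* = End V. *)
Definition coev V : tens V 'Hom(V, k^o) := \sum_i bv i ⊗ dualbasis i.

Lemma coevE V X (b : V -> 'Hom(V, k^o) -> X) : bilin b ->
  tlift b (coev V) = \sum_i b (bv i) (dualbasis i).
Proof. by move=> bl; rewrite linear_sum; apply: eq_bigr => i _ /=; rewrite tliftE. Qed.

Lemma dualbasisE V i (v : V) : dualbasis i v = bc i v.
Proof. by rewrite linfunE // => c x y; rewrite bcP. Qed.

Lemma coev_eval V (v : V) :
  tlift (fun (y : V) (phi : 'Hom(V, k^o)) => (phi v : k) *: y) (coev V) = v.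
Proof.
rewrite coevE; last by multilin.
by rewrite [RHS]bvE; apply: eq_bigr => i _; rewrite dualbasisE.
Qed.

(** As coev is the identity endomorphism, composing with g on either side agrees. *)
Lemma coev_slide V X (g : 'End(V)) (b : V -> 'Hom(V, k^o) -> X) : bilin b ->
  tlift (fun y phi => b (g y) phi) (coev V) =
  tlift (fun y phi => b y (phi \o g)%VF) (coev V).
Proof.
move=> bl; rewrite !coevE; try by multilin.
under eq_bigr => i _.
  have E : b (g (bv i)) (dualbasis i) =
    \sum_j bc j (g (bv i)) *: b (bv j) (dualbasis i).
    set f := dualbasis i; rewrite {1}[g _]bvE.
    have lb : lin (fun x => b x f) by multilin.
    rewrite -[LHS](linfunE lb) linear_sum; apply: eq_bigr => j _.
    by rewrite linearZ /= (linfunE lb).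
  rewrite E; over.
rewrite exchange_big; apply: eq_bigr => j _.
have lb : lin (fun phi => b (bv j) phi) by multilin.
under eq_bigr => i _ do rewrite -(linfunE lb) -linearZ.
rewrite -linear_sum /= (linfunE lb); congr (b _ _); apply/lfunP=> v.
rewrite sum_lfunE comp_lfunE dualbasisE [in RHS](bvE v) linear_sum /=.
have lbc : lin (fun v : V => bc j v : k^o) by multilin.
rewrite -[RHS](linfunE lbc) linear_sum; apply: eq_bigr => i _.
by rewrite linearZ linearZ /= (linfunE lbc) scale_lfunE dualbasisE; exact: mulrC.
Qed.
End TensorMore.

Lemma amullE (k : fieldType) (R : falgType k) (x y : R) : amull x y = x * y.
Proof. by rewrite lfunE. Qed.

(** * Sweedler calculus *)

(** In this file the Sweedler sum of b (h_1, h_2) is tlift b (Delta H h), and that of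
    b (v_(-1), v_(0)) is tlift b (rho v); the lemmas sw_... are the rules of the
    calculus.  The comultiplication is an instance of rho as well as a coaction. *)
Section Coaction.
Variables (k : fieldType) (H : hopfAlg k) (V : vectType k) (rho : 'Hom(V, tens H V)).

Lemma sw_coassoc X (b : H -> H -> V -> X : vectType k) x :
  tassoc (tmap (Delta H) \1 (rho x)) = tmap \1 rho (rho x) -> trilin b ->
  tlift (fun h v => tlift (fun p q => b p q v) (Delta H h)) (rho x) =
  tlift (fun h v => tlift (fun p w => b h p w) (rho v)) (rho x).
Proof.
move=> rhoA bl; have [b1 b2 b3] := bl.
transitivity (tlift (fun t w => tlift (fun u v => b u v w) t) (tmap (Delta H) \1 (rho x))).
  by rewrite tlift_tmap; [apply: eq_tlift => h v; rewrite id_lfunE | multilin].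
rewrite -tlift_tassoc // rhoA tlift_tmap; last by multilin.
by apply: eq_tlift => h v; rewrite id_lfunE.
Qed.

Lemma sw_counit X (f : V -> X : vectType k) x :
  tunitl (tmap (eps H) \1 (rho x)) = x -> lin f ->
  tlift (fun h v => (eps H h : k) *: f v) (rho x) = f x.
Proof.
move=> rho1 lf; rewrite -{2}rho1 -[f _](linfunE lf) -[tunitl _]/(tlift _ _) tlift_map.
rewrite tlift_tmap; last by multilin.
by apply: eq_tlift => h v; rewrite linearZ /= (linfunE lf) id_lfunE.
Qed.
End Coaction.

Section Antipode.
Variables (k : fieldType) (H : hopfAlg k).
Implicit Types (X : vectType k) (h x y : H).
Local Notation S := (antipode H).
Local Notation D := (Delta H).
Local Notation e := (eps H).

Lemma sw_assoc X (b : H -> H -> H -> X) h : trilin b ->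
  tlift (fun x y => tlift (fun p q => b p q y) (D x)) (D h) =
  tlift (fun x y => tlift (fun p q => b x p q) (D y)) (D h).
Proof. exact/sw_coassoc/coassoc. Qed.

Lemma sw_epsl X (f : H -> X) h : lin f ->
  tlift (fun x y => (e x : k) *: f y) (D h) = f h.
Proof. exact/sw_counit/counitl. Qed.

Lemma sw_epsr X (f : H -> X) h : lin f ->
  tlift (fun x y => (e y : k) *: f x) (D h) = f h.
Proof.
move=> lf; rewrite -{2}(counitr h) -[f _](linfunE lf) -[tunitr _]/(tlift _ _) tlift_map.
rewrite tlift_tmap; last by multilin.
by apply: eq_tlift => x y; rewrite linearZ /= (linfunE lf) id_lfunE.
Qed.

Lemma sw_antipodel X (f : H -> X) h : lin f ->
  tlift (fun x y => f (S x * y)) (D h) = (e h : k) *: f 1.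
Proof.
move=> lf; have := congr1 (linfun f) (antipodel h).
rewrite tlift_map linearZ /= (linfunE lf) => <-.
by apply: eq_tlift => x y; rewrite (linfunE lf).
Qed.

Lemma sw_antipoder X (f : H -> X) h : lin f ->
  tlift (fun x y => f (x * S y)) (D h) = (e h : k) *: f 1.
Proof.
move=> lf; have := congr1 (linfun f) (antipoder h).
rewrite tlift_map linearZ /= (linfunE lf) => <-.
by apply: eq_tlift => x y; rewrite (linfunE lf).
Qed.

Lemma sw_mul X (b : H -> H -> X) x y : bilin b ->
  tlift b (D (x * y)) =
  tlift (fun x1 x2 => tlift (fun y1 y2 => b (x1 * y1) (x2 * y2)) (D y)) (D x).
Proof. by move=> bl; rewrite rmorphM tlift_mul. Qed.

(** Both sides equal the sum E of S(x_1 y_1) x_2 y_2 S(y_3) S(x_3): cancelling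
    y_2 S(y_3) and then x_2 S(x_3) leaves the left side, cancelling
    S(x_1 y_1) x_2 y_2 the right one. *)
Lemma antipodeM x y : S (x * y) = S y * S x.
Proof.
pose E := tlift (fun a b => tlift (fun p q => tlift (fun c d =>
   tlift (fun u v => S (p * u) * (q * v) * (S d * S b)) (D c)) (D y)) (D a)) (D x).
transitivity E; rewrite /E.
  under eq_tlift => a b.
    under eq_tlift => p q.
      rewrite sw_assoc; last by split; multilin.
      under eq_tlift => c d.
        under eq_tlift => u v.
          rewrite (_ : _ * _ * _ = S (p * c) * q * (u * S v) * S b); last by rewrite !mulrA.
          over.
        rewrite (@sw_antipoder _ (fun z => S (p * c) * q * z * S b)); last by multilin.
        rewrite mulr1; over.
      rewrite (@sw_epsr _ (fun c => S (p * c) * q * S b)); last by multilin.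
      over.
    over.
  rewrite sw_assoc; last by split; multilin.
  under eq_tlift => p b'.
    under eq_tlift => q b do rewrite -mulrA.
    rewrite (@sw_antipoder _ (fun z => S (p * y) * z)); last by multilin.
    rewrite mulr1; over.
  by rewrite (@sw_epsr _ (fun p => S (p * y))); last by multilin.
under eq_tlift => a b.
  rewrite tlift_exchange; under eq_tlift => c d.
    rewrite -(@sw_mul _ (fun m n => S m * n * (S d * S b))); last by multilin.
    rewrite (@sw_antipodel _ (fun z => z * (S d * S b))); last by multilin.
    rewrite mul1r rmorphM -scalerA; over.
  under eq_tlift => c d do rewrite scalerA mulrC -scalerA.
  rewrite (@sw_epsl _ (fun d => (e a : k) *: (S d * S b))); last by multilin.
  over.
by rewrite (@sw_epsl _ (fun b => S y * S b)); last by multilin.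
Qed.
End Antipode.

(** * Integrals and bijectivity of the antipode *)

Section AntipodeMore.
Variables (k : fieldType) (H : hopfAlg k).
Implicit Types (X : vectType k) (h x y : H).
Local Notation S := (antipode H).
Local Notation D := (Delta H).
Local Notation e := (eps H).

Lemma antipode1 : S 1 = 1.
Proof.
have := antipodel (1 : H); rewrite !rmorph1 -tpure11 tliftE; last by multilin.
by rewrite mulr1 scale1r.
Qed.

Lemma antipode_cancell h :
  tlift (fun x y => (S x ⊗ 1) * D y) (D h) = 1 ⊗ h.
Proof.
under eq_tlift => x y.
  rewrite -[_ * _]tlift_pure tlift_mul; last exact: tpure_bilin.
  rewrite tliftE; last by multilin.
  under eq_tlift => p q do rewrite mul1r.
  over.
rewrite -sw_assoc; last by split; multilin.
under eq_tlift => x y.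
  rewrite (@sw_antipodel _ _ _ (fun z => z ⊗ y)); last by multilin.
  over.
by rewrite (@sw_epsl _ _ _ (fun y => 1 ⊗ y)); last by multilin.
Qed.

(** In the convolution algebra of maps from H to H ⊗ H, Delta S is a left inverse of
    Delta and the map N below is a right inverse. *)
Lemma Delta_antipode h : D (S h) = tlift (fun x y => S y ⊗ S x) (D h).
Proof.
pose N h := tlift (fun x y => S y ⊗ S x) (D h).
have DN y : tlift (fun p q => D p * N q) (D y) = (e y : k) *: 1.
  under eq_tlift => p q.
    rewrite mulr_tliftr; under eq_tlift => u v.
      rewrite -[S v]mul1r -[S u]mulr1 -tpureM mulrA; over.
    over.
  rewrite -(@sw_assoc _ _ _ (fun a b c => D a * 1 ⊗ S b * S c ⊗ 1)); last by split; multilin.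
  under eq_tlift => p q do rewrite -mulr_tliftl antipode_cancel tpureM mul1r.
  by rewrite (@sw_antipoder _ _ _ (fun w => w ⊗ 1)); last by multilin.
transitivity (tlift (fun a c => tlift (fun p q => D (S p) * D q * N c) (D a)) (D h)).
  rewrite sw_assoc; last by split; rewrite /N; multilin.
  under [RHS]eq_tlift => p c.
    under eq_tlift => q d do rewrite -mulrA.
    rewrite -mulr_tliftr DN -scalerAr mulr1; over.
  by rewrite (@sw_epsr _ _ _ (fun a => D (S a))); last by multilin.
have DM x y : D x * D y = D (x * y) by rewrite rmorphM.
under eq_tlift => a c.
  under eq_tlift => p q do rewrite DM.
  rewrite (@sw_antipodel _ _ _ (fun w => D w * N c)); last by multilin.
  rewrite rmorph1 mul1r; over.
by rewrite (@sw_epsl _ _ _ N); last by rewrite /N; multilin.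
Qed.

Definition integral (L : H) : Prop := forall g, g * L = (e g : k) *: L.

(** Insert S(h_1) h_2 to the left of L_1; then h_2 L_1 ⊗ h_3 L_2 is
    Delta(h_2 L) = eps(h_2) Delta(L). *)
Lemma integral_slide (L : H) h : integral L ->
  (1 ⊗ h) * D L = (S h ⊗ 1) * D L.
Proof.
move=> intL; rewrite -antipode_cancell mulr_tliftl.
have DM x y : D x * D y = D (x * y) by rewrite rmorphM.
under eq_tlift => x y do rewrite -mulrA DM intL linearZ /= -scalerAr.
by rewrite (@sw_epsr _ _ _ (fun x => (S x ⊗ 1) * D L)); last by multilin.
Qed.

(** Let X be the dual of H with h acting by phi |-> phi (S(h) -).  Then coev is an
    invariant of H ⊗ X for the diagonal action, and y ⊗ phi |-> y_1 ⊗ S(y_2) phi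
    carries the diagonal action to the action on the first factor.  The image of coev
    is thus invariant in the first factor; this is its value at z. *)
Definition coev_integral (z : H) : H :=
  tlift (fun y (phi : Hdual H) =>
    tlift (fun a b => (phi (S (S b) * z) : k) *: a) (D y)) (coev H).

Lemma coev_integralP z : integral (coev_integral z).
Proof.
move=> g.
pose M := tlift (fun p q => tlift (fun y (phi : Hdual H) =>
  tlift (fun a b => (phi (S q * (S (S b) * z)) : k) *: a) (D (p * y))) (coev H)) (D g).
(* M is the sum over g of the image of the diagonal translate g_1 e_i ⊗ g_2 e^i. *)
transitivity M; rewrite /M.
  under [RHS]eq_tlift => p q.
    under eq_tlift => y phi.
      rewrite sw_mul; last by multilin.
      over.
    over.
  rewrite [RHS]tlift_exchange /coev_integral mulr_tliftr; apply: eq_tlift => y phi.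
  rewrite [RHS](@sw_assoc _ _ _ (fun p1 p2 q => tlift (fun y1 y2 =>
    (phi (S q * (S (S (p2 * y2)) * z)) : k) *: (p1 * y1)) (D y))); last by split; multilin.
  under [RHS]eq_tlift => p1 r.
    rewrite (tlift_exchange _ (D r) (D y)); under eq_tlift => a b.
      under eq_tlift => p2 q.
        rewrite (_ : S q * _ = S (S p2 * q) * (S (S b) * z)); last first.
          by rewrite !antipodeM !mulrA.
        over.
      rewrite (@sw_antipodel _ _ _ (fun w =>
        (phi (S w * (S (S b) * z)) : k) *: (p1 * a))); last by multilin.
      rewrite antipode1 mul1r; over.
    rewrite -scaler_tlift; over.
  rewrite (@sw_epsr _ _ _ (fun p1 => tlift (fun a b =>
    (phi (S (S b) * z) : k) *: (p1 * a)) (D y))); last by multilin.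
  by rewrite mulr_tliftr; apply: eq_tlift => a b; rewrite scalerAr.
(* Invariance of coev: slide g_1 to the other factor, where it meets S(g_2). *)
transitivity (tlift (fun p q => tlift (fun y (phi : Hdual H) => tlift (fun a b =>
    (phi (p * S q * (S (S b) * z)) : k) *: a) (D y)) (coev H)) (D g)).
  apply: eq_tlift => p q.
  pose B y (phi : Hdual H) :=
    tlift (fun a b => (phi (S q * (S (S b) * z)) : k) *: a) (D y).
  transitivity (tlift (fun y phi => B (amull p y) phi) (coev H)).
    by apply: eq_tlift => y phi; rewrite /B amullE.
  rewrite coev_slide; last by rewrite /B; multilin.
  apply: eq_tlift => y phi; apply: eq_tlift => a b.
  by rewrite comp_lfunE amullE !mulrA.
rewrite [LHS]tlift_exchange /coev_integral scaler_tlift; apply: eq_tlift => y phi.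
rewrite [LHS]tlift_exchange scaler_tlift; apply: eq_tlift => a b.
rewrite (@sw_antipoder _ _ _ (fun w => (phi (w * (S (S b) * z)) : k) *: a)); last by multilin.
by rewrite mul1r.
Qed.

(** The map y ⊗ phi |-> y_1 ⊗ S(y_2) phi has the left inverse
    y ⊗ phi |-> y_1 ⊗ y_2 phi, and coev is not zero.  Here theta is the image of coev,
    and G is the left inverse followed by evaluation at 1. *)
Lemma coev_integral_not_all0 : ~ (forall z, coev_integral z = 0).
Proof.
move=> L0.
pose theta := tlift (fun y (phi : Hdual H) =>
  tlift (fun a b => a ⊗ (phi \o amull (S (S b)))%VF : tens H (Hdual H)) (D y)) (coev H).
have theta0 : theta = 0.
  pose ev (z : H) : 'Hom(Hdual H, k^o) := linfun (fun phi : Hdual H => phi z).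
  have evE z phi : ev z phi = phi z by rewrite linfunE //; multilin.
  apply: (tens_sep (f := ev)) => [phi h|z].
    by apply/lfunP=> z; rewrite -evE h zero_lfunE.
  transitivity (coev_integral z ⊗ (1 : k^o)); last first.
    by rewrite L0; exact: (linear0 (tpurer (1 : k^o))).
  rewrite -[RHS](lfunE (tpurer (1 : k^o))) /theta !tlift_map; apply: eq_tlift => y phi.
  rewrite !tlift_map; apply: eq_tlift => a b.
  rewrite tmapE id_lfunE evE comp_lfunE amullE [RHS]lfunE.
  apply: etrans (esym (tpureZl _ a (1 : k^o))); rewrite -tpureZr.
  by congr (_ ⊗ _); apply: (esym (mulr1 _)).
have /eqP := coev_eval (1 : H); rewrite eq_sym; apply/negP.
rewrite (_ : tlift _ _ = 0) ?oner_eq0 //.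
pose G (a : H) (phi : Hdual H) := tlift (fun p q => (phi (S q) : k) *: p) (D a).
have GE a b (phi : Hdual H) : G a (phi \o amull (S (S b)))%VF =
   tlift (fun p q => (phi (S (q * S b)) : k) *: p) (D a).
  by apply: eq_tlift => p q; rewrite comp_lfunE amullE antipodeM.
have Gb : bilin G by rewrite /G; multilin.
transitivity (tlift G theta); last by rewrite theta0 linear0.
rewrite tlift_map; apply: eq_tlift => y phi; rewrite tlift_map.
under [RHS]eq_tlift => a b do rewrite tliftE // GE.
rewrite sw_assoc; last by split; multilin.
under [RHS]eq_tlift => p r.
  rewrite (@sw_antipoder _ _ _ (fun w => (phi (S w) : k) *: p)); last by multilin.
  rewrite antipode1; over.
by rewrite (@sw_epsr _ _ _ (fun p => (phi 1 : k) *: p)); last by multilin.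
Qed.

(** If h were not zero, every integral L would vanish, as L ⊗ h = 0. *)
Lemma antipode_inj h : S h = 0 -> h = 0.
Proof.
move=> Sh0; apply/eqP; apply: contraT => h0; case: coev_integral_not_all0 => z.
have intL := coev_integralP z; move: (coev_integral z) intL => L intL.
apply: (tpure_eq0l (v := h)) => //.
have Z y : tlift (fun a b => a ⊗ (h * y * b)) (D L) = 0.
  transitivity ((1 ⊗ h) * ((1 ⊗ y) * D L)).
    rewrite mulrA tpureM mulr1 -[RHS]tlift_pure tlift_mul; last exact: tpure_bilin.
    by rewrite tliftE; [apply: eq_tlift => a b; rewrite mul1r | multilin].
  rewrite integral_slide // mulrA tpureM mulr1 mul1r.
  rewrite -[S y]mulr1 -[h]mul1r -tpureM -mulrA integral_slide // Sh0.
  by rewrite -[0 ⊗ _]/(tpurer _ _) linear0 mul0r mulr0.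
transitivity (tlift (fun a b => tlift (fun p q => p ⊗ (h * S q * b)) (D a)) (D L)).
  rewrite sw_assoc; last by split; multilin.
  under [RHS]eq_tlift => p r.
    under eq_tlift => q b do rewrite -mulrA.
    rewrite (@sw_antipodel _ _ _ (fun w => p ⊗ (h * w))); last by multilin.
    rewrite mulr1; over.
  by rewrite (@sw_epsr _ _ _ (fun p => p ⊗ h)); last by multilin.
(* Z applies to a fixed y: expand S(L_2) in the basis of H. *)
transitivity (\sum_i tlift (fun a b =>
  tlift (fun p q => (bc i (S q)) *: (p ⊗ (h * bv i * b))) (D a)) (D L)).
  rewrite -tlift_bigsum; apply: eq_tlift => a b; rewrite -tlift_bigsum; apply: eq_tlift => p q.
  rewrite {1}[S q]bvE mulr_sumr mulr_suml linear_sum; apply: eq_bigr => i _.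
  by rewrite -scalerAr -scalerAl linearZ.
rewrite big1 // => i _.
pose B a (c : H) := tlift (fun p q => (bc i (S q)) *: (p ⊗ c)) (D a).
have Bb : bilin B by rewrite /B; multilin.
by rewrite -(tlift_tlift id (fun b => h * bv i * b) _ Bb) Z linear0.
Qed.
End AntipodeMore.

Section AntipodeInverse.
Variables (k : fieldType) (H : hopfAlg k).
Implicit Types (X : vectType k) (h x y : H).
Local Notation S := (antipode H).
Local Notation T := ((antipode H)^-1)%VF.
Local Notation D := (Delta H).
Local Notation e := (eps H).

Lemma antipode_ker : lker S == 0%VS.
Proof.
apply/lker0P => x y /eqP; rewrite -subr_eq0 -linearB => /eqP/antipode_inj/eqP.
by rewrite subr_eq0 => /eqP.
Qed.

Lemma antipodeK : cancel S T.
Proof. exact: lker0_lfunK antipode_ker. Qed.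

Lemma antipodeVK : cancel T S.
Proof. exact: lker0_lfunVK antipode_ker. Qed.

(** S^-1(h_2) h_1 = S^-1 (S(h_1) h_2), and similarly in the next lemma. *)
Lemma sw_antipodeVl X (f : H -> X) h : lin f ->
  tlift (fun x y => f (T y * x)) (D h) = (e h : k) *: f 1.
Proof.
move=> lf; under eq_tlift => x y.
  rewrite -[_ * _]antipodeK antipodeM antipodeVK; over.
rewrite (@sw_antipodel _ _ _ (fun w => f (T w))); last first.
  by move=> c x y; rewrite linearP lf.
by rewrite -[in T 1](antipode1 H) antipodeK.
Qed.

Lemma sw_antipodeVr X (f : H -> X) h : lin f ->
  tlift (fun x y => f (y * T x)) (D h) = (e h : k) *: f 1.
Proof.
move=> lf; under eq_tlift => x y.
  rewrite -[_ * _]antipodeK antipodeM antipodeVK; over.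
rewrite (@sw_antipoder _ _ _ (fun w => f (T w))); last first.
  by move=> c x y; rewrite linearP lf.
by rewrite -[in T 1](antipode1 H) antipodeK.
Qed.

Lemma Delta_antipodeV h : D (T h) = tlift (fun x y => T y ⊗ T x) (D h).
Proof.
rewrite -[in RHS](antipodeVK h) Delta_antipode.
rewrite (@tlift_map _ _ _ _ _ _ (tlift (fun x y => T y ⊗ T x))).
under [RHS]eq_tlift => x y.
  rewrite tliftE; last by multilin.
  rewrite !antipodeK; over.
by rewrite tlift_pure.
Qed.
End AntipodeInverse.

(** * Equivalences and internal Homs *)

Section Isomorphisms.
Variable C : category.

Lemma iso_mono (X Y Z : C) (f : hom Y Z) (g h : hom X Y) :
  is_iso f -> f ∘ g = f ∘ h -> g = h.
Proof. by case=> f' [ff' _] E; rewrite -[g]comp1m -[h]comp1m -ff' -!compA E. Qed.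

Lemma iso_epi (X Y Z : C) (f : hom X Y) (g h : hom Y Z) :
  is_iso f -> g ∘ f = h ∘ f -> g = h.
Proof. by case=> f' [_ ff'] E; rewrite -[g]compm1 -[h]compm1 -ff' !compA E. Qed.

End Isomorphisms.

Section Equivalence.
Variables (C D : category) (F : functor C D).
Hypothesis eF : is_equivalence F.

Lemma equiv_faithful X Y : injective (@fmor C D F X Y).
Proof.
case: eF => G [eta [theta [eta_iso eta_nat _ _]]] f g E.
by apply: (iso_mono (eta_iso Y)); rewrite !eta_nat E.
Qed.

Lemma equiv_full X Y (g : hom (F X) (F Y)) : exists f, fmor F f = g.
Proof.
case: (eF) => G [eta [theta [eta_iso eta_nat theta_iso theta_nat]]].
(* G is faithful, by the same argument as for F. *)
have G_faithful Z W (u v : hom Z W) : fmor G u = fmor G v -> u = v.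
  by move=> E; apply: (iso_epi (theta_iso Z)); rewrite -!theta_nat E.
have [etaV [eV1 eV2]] := eta_iso Y.
exists (etaV ∘ (fmor G g ∘ eta X)); apply: G_faithful; apply: (iso_epi (eta_iso X)).
by rewrite -eta_nat !compA eV2 comp1m.
Qed.
End Equivalence.

Section InternalHom.
Variables (k : fieldType) (H : hopfAlg k).

(** u : R ⊗ M -> N is universal, that is, R represents X |-> Hom (X ⊗ M, N). *)
Definition internal_hom (C : modcat_data H) (M N : C) (R : fdmod_cat H)
    (u : hom (mc_act R M) N) : Prop :=
  forall (X : fdmod_cat H) (phi : hom (mc_act X M) N),
  exists f : hom X R, u ∘ mc_actm f (idm M) = phi /\
    forall g : hom X R, u ∘ mc_actm g (idm M) = phi -> g = f.

Lemma internal_hom_unique (C : modcat_data H) (M N : C) (R R' : fdmod_cat H)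
    (u : hom (mc_act R M) N) (u' : hom (mc_act R' M) N) :
  internal_hom u -> internal_hom u' -> exists f : hom R R', is_iso f.
Proof.
move=> uP u'P; have [f [fu _]] := u'P _ u; have [g [gu _]] := uP _ u'.
have actM (X Y Z : fdmod_cat H) (h : hom Y Z) (l : hom X Y) :
    mc_actm (h ∘ l) (idm M) = mc_actm h (idm M) ∘ mc_actm l (idm M).
  by rewrite -mc_actmM comp1m.
exists f, g; split.
  have [h [_ hU]] := uP _ u.
  transitivity h; [|symmetry]; apply: hU; last by rewrite mc_actm1 compm1.
  by rewrite actM compA gu.
have [h [_ hU]] := u'P _ u'.
transitivity h; [|symmetry]; apply: hU; last by rewrite mc_actm1 compm1.
by rewrite actM compA fu.
Qed.

(** The new universal morphism is F u after the inverse of c_(R, M); morphisms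
    X ⊗ F M -> F N correspond to morphisms F (X ⊗ M) -> F N by c_(X, M), and to
    morphisms X ⊗ M -> N because F is fully faithful. *)
Lemma internal_hom_equiv (C D : modcat_data H) (F : modfunctor C D) (M N : C)
    (R : fdmod_cat H) (u : hom (mc_act R M) N) :
  is_equivalence F -> internal_hom u ->
  exists v : hom (mc_act R (F M)) (F N), internal_hom v.
Proof.
move=> eF uP; have [cV [cVc ccV]] := mf_c_iso F R M.
exists (fmor F u ∘ cV) => X phi.
have step (g : hom X R) :
    fmor F (mc_actm g (idm M)) = cV ∘ mc_actm g (idm (F M)) ∘ mf_c F X M.
  by rewrite -(fmor1 F M) -compA -mf_c_nat compA cVc comp1m.
have [psi psiE] := equiv_full eF (phi ∘ mf_c F X M).
have trans (g : hom X R) :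
    fmor F u ∘ cV ∘ mc_actm g (idm (F M)) = phi <-> u ∘ mc_actm g (idm M) = psi.
  split=> E.
    by apply: (equiv_faithful eF); rewrite fmorM step psiE -E !compA.
  apply: (iso_epi (mf_c_iso F X M)); rewrite -psiE -E fmorM step.
  by rewrite !compA.
have [f [fu fU]] := uP _ psi; exists f; split; first exact/trans.
by move=> g /trans; apply: fU.
Qed.
End InternalHom.

(** * Semisimplicity and irreducibility *)

(** Von Neumann regularity of morphisms, a form of semisimplicity that refers to
    neither kernels nor sums. *)
Definition vnregular (C : category) : Prop :=
  forall (X Y : C) (f : hom X Y), exists r, f ∘ r ∘ f = f.

Lemma equiv_vnregular (C D : category) (F : functor C D) :
  is_equivalence F -> vnregular C -> vnregular D.
Proof.
case=> G [eta [theta [_ _ theta_iso theta_nat]]] regC X Y f.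
have [r rE] := regC _ _ (fmor G f); have [tY [tY1 tY2]] := theta_iso Y.
exists (theta X ∘ (fmor F r ∘ tY)); apply: (iso_epi (theta_iso X)).
rewrite -!compA -theta_nat (compA tY) tY1 comp1m (compA f) -theta_nat.
by rewrite -!compA -!fmorM !compA rE.
Qed.

(** Maschke: average a linear pseudo-inverse of f over A. *)
Lemma Amod_vnregular (k : closedFieldType) (char0 : [pchar k] =i pred0) (H : hopfAlg k)
  (A : glsubgroup H) : vnregular (Amod_cat A).
Proof.
move=> V W f; have /AhomsP fA := subvsP f.
pose c (a : A) := (am_act V a \o (vsval f)^-1 \o am_act W a^-1%g)%VF.
pose r := #|A|%:R^-1 *: \sum_(a : A) c a.
have cA a b : (c a \o am_act W b = am_act V b \o c (b^-1 * a)%g)%VF.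
  rewrite /c !comp_lfunA -am_actM mulgA mulgV mul1g -!comp_lfunA -am_actM.
  by rewrite invMg invgK.
have rA : r \in Ahoms W V.
  apply/AhomsP=> b; rewrite /r -comp_lfunZl -comp_lfunZr; congr (_ *: _).
  apply/lfunP=> v; rewrite !comp_lfunE !sum_lfunE linear_sum.
  rewrite [RHS](reindex_inj (mulgI b^-1%g)); apply: eq_bigr => a _ /=.
  by rewrite -comp_lfunE cA comp_lfunE.
exists (Subvs rA); apply: subvs_inj; apply/lfunP=> v; rewrite /= !comp_lfunE.
rewrite /r scale_lfunE sum_lfunE linearZ linear_sum /=.
rewrite (eq_bigr (fun=> vsval f v)) => [|a _]; last first.
  have fE b u : vsval f (am_act V b u) = am_act W b (vsval f u).
    by rewrite -comp_lfunE fA comp_lfunE.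
  rewrite !comp_lfunE fE -(fE a^-1%g) limg_lfunVK ?memv_img ?memvf //.
  by rewrite -fE -comp_lfunE -am_actM mulgV am_act1 id_lfunE.
rewrite sumr_const -scaler_nat scalerA mulVf ?scale1r //.
by rewrite ((pcharf0P _).1 char0) -lt0n; apply/card_gt0P; exists 1%g.
Qed.

(** If i is the inclusion of U and i r i = i, then e = i r. *)
Lemma submodule_idempotent (k : fieldType) (R : falgType k) (M : fdmod R) (U : {vspace M}) :
  vnregular (fdmod_cat R) -> submodule U ->
  exists e : hom (M : fdmod_cat R) M, e ∘ e = e /\ limg (vsval e) = U.
Proof.
move=> reg stU.
have iP : linfun (@vsval k M U) \in fdhoms (fdsub stU) M.
  apply/intertwinersP=> a; apply/lfunP=> u; rewrite !comp_lfunE !lfunE /=.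
  exact: fdsub_funE.
pose i : hom (fdsub stU : fdmod_cat R) M := Subvs iP.
have [r rE] := reg _ _ i; exists (i ∘ r); split; first by rewrite compA rE.
apply/vspaceP=> u; apply/memv_imgP/idP=> [[v _ ->]|uU].
  by rewrite /= comp_lfunE lfunE subvsP.
exists u; rewrite ?memvf //; have /(congr1 vsval)/lfunP/(_ (Subvs uU)) := rE.
by rewrite /= !comp_lfunE !lfunE.
Qed.

Lemma vnregular_completely_reducible (k : fieldType) (R : falgType k) (M : fdmod R) :
  vnregular (fdmod_cat R) -> completely_reducible M.
Proof.
move=> reg U stU; have [e [ee <-]] := submodule_idempotent reg stU.
have {}ee x : vsval e (vsval e x) = vsval e x.
  by rewrite -[in RHS]ee /= comp_lfunE.
have /intertwinersP eR := subvsP e.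
exists (lker (vsval e)); split.
- move=> a u; rewrite !memv_ker => /eqP eu.
  by rewrite -comp_lfunE eR comp_lfunE eu linear0.
- apply/vspaceP=> x; rewrite memvf; apply/memv_addP.
  exists (vsval e x); first by rewrite memv_img ?memvf.
  exists (x - vsval e x); last by rewrite addrC subrK.
  by rewrite memv_ker linearB /= ee subrr.
apply/eqP; rewrite -subv0; apply/subvP=> x; rewrite memv_cap memv0.
by case/andP=> /memv_imgP[y _ ->]; rewrite memv_ker ee.
Qed.

Lemma irreducible_of_idempotents (k : fieldType) (R : falgType k) (M : fdmod R) :
  vnregular (fdmod_cat R) -> fullv != 0%VS :> {vspace M} ->
  (forall e : hom (M : fdmod_cat R) M, e ∘ e = e -> e = 0 \/ e = idm _) ->
  irreducible_mod M.
Proof.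
move=> reg nz idem; split=> // U stU.
have [e [ee <-]] := submodule_idempotent reg stU.
case: (idem e ee) => ->; [left | right; exact: lim1g].
have e0 : vsval (0 : subvs_of (fdhoms M M)) = 0 by exact: linear0.
by rewrite -[X in limg X]/(vsval (0 : subvs_of (fdhoms M M))) e0 lim0g.
Qed.

(** F is not known to be additive; but 0 is an idempotent of End (F X) distinct from
    the identity, so that F z = 0 by counting. *)
Lemma equiv_idempotents (k : fieldType) (R : falgType k) (C : category)
    (F : functor C (fdmod_cat R)) (X : C) (z : hom X X) :
  is_equivalence F -> z <> idm X ->
  (forall e : hom X X, e ∘ e = e -> e = z \/ e = idm X) ->
  fullv != 0%VS :> {vspace (F X : fdmod R)} /\
  (forall e : hom (F X) (F X), e ∘ e = e -> e = 0 \/ e = idm _).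
Proof.
move=> eF z1 idX; have Ff := equiv_faithful eF.
have idF (e : hom (F X) (F X)) : e ∘ e = e -> e = fmor F z \/ e = idm _.
  have [e' <-] := equiv_full eF e; rewrite -fmorM => /Ff/idX[]->; first by left.
  by right; rewrite fmor1.
have nz : idm (F X) <> 0.
  move=> id0; apply: z1; apply: Ff; rewrite -[fmor F z]comp1m -[fmor F (idm X)]comp1m id0.
  by apply: subvs_inj; apply: etrans (comp_lfun0l _ _) (esym (comp_lfun0l _ _)).
have z0 : fmor F z = 0.
  case: (idF 0) => [|//|/esym//].
  by apply: subvs_inj; apply: comp_lfun0l.
split; last by move=> e /idF; rewrite z0.
apply/eqP=> V0; apply: nz; apply: subvs_inj; apply/lfunP=> v /=.
have : v \in (fullv : {vspace (F X : fdmod R)}) by rewrite memvf.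
by rewrite V0 memv0 => /eqP->; rewrite !linear0.
Qed.

(** * The internal Hom between characters *)

Section CharacterInternalHom.
Variables (k : closedFieldType) (H : hopfAlg k) (A : glsubgroup H).
Variables (J : chargroup k A -> tens H H) (twistJ : dynamical_twist J).
Variables l m : chargroup k A.

Let C := Cmod (l * m^-1)%g.
Local Notation kl := (charmod l^-1%g).
Local Notation km := (charmod m^-1%g).

Lemma CmodE h (f : C) t : vsval (fm_act C h f) t = vsval f (t * h).
Proof.
rewrite (fdsub_funE (@Cspace_submodule _ _ _ (l * m^-1)%g)).
by rewrite [fm_act _ _](linfunE (@rtrans_linear _ H)) rtransE.
Qed.

Definition Ceval : 'Hom(tens C k^o, k^o) :=
  tlift (fun (f : C) (c : k^o) => (c : k) *: vsval f 1).

Lemma CevalE (f : C) (c : k^o) : Ceval (f ⊗ c) = (c : k) *: vsval f 1.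
Proof. by rewrite /Ceval tliftE //; multilin. Qed.

Lemma Ceval_hom : Ceval \in Ahoms (Atens C kl) km.
Proof.
apply/AhomsP=> a; apply: text => f c; rewrite !comp_lfunE.
transitivity (Ceval (fm_act C (gl_emb a) f ⊗ ((l^-1)%g a *: c : k^o))).
  congr (Ceval _); apply: etrans (tmapE _ _ _ _) _; congr (_ ⊗ _).
  by rewrite scale_lfunE id_lfunE.
transitivity ((m^-1)%g a *: Ceval (f ⊗ (c : k^o))); last first.
  by rewrite scale_lfunE id_lfunE.
rewrite !CevalE CmodE mul1r.
have /CspaceP fC := subvsP f; rewrite -[gl_emb a]mulr1 fC charMl !charVl.
rewrite !scalerA; congr (_ *: _); rewrite -[(l a)^-1 *: c]/((l a)^-1 * c).
by rewrite mulrACA mulVf ?char_neq0 // mul1r mulrC.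
Qed.

(** phi corresponds to the map from X to C sending x to t |-> phi (t x ⊗ 1); the weight
    l m^-1 is what A-linearity of phi gives for t in A. *)
Lemma charmod_internal_hom : exists u, @internal_hom _ _ (catJ twistJ) kl km C u.
Proof.
exists (Subvs Ceval_hom) => X phi; have /AhomsP phiA := subvsP phi.
pose g x : Hdual H := linfun (fun t : H => vsval phi (fm_act X t x ⊗ (1 : k^o))).
have gE x t : g x t = vsval phi (fm_act X t x ⊗ (1 : k^o)).
  by rewrite /g linfunE //; multilin.
have gC x : g x \in Cspace (l * m^-1)%g.
  apply/CspaceP=> a t; rewrite !gE.
  have /lfunP/(_ (fm_act X t x ⊗ (1 : k^o))) := phiA a.
  rewrite !comp_lfunE tmapE !scale_lfunE !id_lfunE tpureZr linearZ /= -comp_lfunE -fm_actM.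
  move/(congr1 (fun z => l a *: z)); rewrite !scalerA charVl mulfV ?char_neq0 // scale1r => ->.
  by rewrite !ffunE.
have glin : lin g.
  move=> c x y; apply/lfunP=> t; rewrite add_lfunE scale_lfunE !gE.
  by rewrite linearP tpurePl linearP.
pose f : 'Hom(X, C) := linfun (fun x => vsproj (Cspace (l * m^-1)%g) (g x)).
have fE x : vsval (f x) = g x.
  rewrite /f linfunE ?vsprojK // => c y z.
  by rewrite glin linearP.
have fH : f \in fdhoms X C.
  apply/intertwinersP=> h; apply/lfunP=> x; apply: subvs_inj; apply/lfunP=> t.
  by rewrite !comp_lfunE fE gE CmodE fE gE -comp_lfunE -fm_actM.
exists (Subvs fH); split.
  apply: subvs_inj; apply: text => x c; rewrite /= comp_lfunE tmapE CevalE fE gE.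
  by rewrite fm_act1 !id_lfunE -linearZ -tpureZr /= [c%:A]mulr1.
move=> f' f'u; apply: subvs_inj; apply/lfunP=> x; apply: subvs_inj; apply/lfunP=> t.
rewrite /= fE gE -f'u /= comp_lfunE tmapE CevalE id_lfunE scale1r.
have /intertwinersP/(_ t)/lfunP/(_ x) := subvsP f'; rewrite !comp_lfunE => ->.
by rewrite CmodE mul1r.
Qed.
End CharacterInternalHom.

(** * The stabilizer as an internal Hom *)

(** H^* ⊗ U as the space of linear functions from H to U. *)
Section FunctionSpace.
Variables (k : fieldType) (H : hopfAlg k) (U : vectType k).

Definition evalat (t : H) : 'Hom(tens (Hdual H) U, U) :=
  tlift (fun (g : Hdual H) u => (g t : k) *: u).

Lemma evalatE t g u : evalat t (g ⊗ u) = (g t : k) *: u.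
Proof. by rewrite /evalat tliftE //; multilin. Qed.

Definition tensfun (F : H -> U) : tens (Hdual H) U :=
  \sum_i dualbasis i ⊗ F (bv i).

Lemma evalat_tensfun F t : lin F -> evalat t (tensfun F) = F t.
Proof.
move=> lF; rewrite linear_sum [in RHS](bvE t) -[RHS](linfunE lF) linear_sum.
by apply: eq_bigr => i _ /=; rewrite evalatE dualbasisE linearZ /= (linfunE lF).
Qed.

Lemma tensfunK s : tensfun (fun t => evalat t s) = s.
Proof.
elim/tens_ind: s => [g u|c s s' IH IH'].
  have gE : g = \sum_i (g (bv i) : k) *: dualbasis i.
    apply/lfunP=> t; rewrite [in LHS](bvE t) linear_sum sum_lfunE; apply: eq_bigr => i _.
    by rewrite linearZ scale_lfunE dualbasisE; exact: mulrC.
  rewrite [in RHS]gE tpure_suml; apply: eq_bigr => i _.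
  by rewrite evalatE tpureZl tpureZr.
rewrite -[in RHS]IH -[in RHS]IH' /tensfun scaler_sumr -big_split; apply: eq_bigr => i _ /=.
by rewrite linearP tpurePr.
Qed.

Lemma evalat_inj s s' : (forall t, evalat t s = evalat t s') -> s = s'.
Proof. by move=> E; rewrite -[s]tensfunK -[s']tensfunK; apply: eq_bigr => i _; rewrite E. Qed.
End FunctionSpace.
Arguments evalat {k H U} t.

Section StabInternalHom.
Variables (k : fieldType) (H : hopfAlg k) (K : comodAlg H) (V W : fdmod K).
Local Notation T := ((antipode H)^-1)%VF.
Local Notation D := (Delta H).
Local Notation rho := (coact K).

Lemma sw_coact_assoc X (b : H -> H -> K -> X : vectType k) a : trilin b ->
  tlift (fun h x => tlift (fun p q => b p q x) (D h)) (rho a) =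
  tlift (fun h x => tlift (fun p y => b h p y) (rho x)) (rho a).
Proof. exact/sw_coassoc/coactA. Qed.

Lemma sw_coact_counit X (f : K -> X : vectType k) a : lin f ->
  tlift (fun h x => (eps H h : k) *: f x) (rho a) = f a.
Proof. exact/sw_counit/coact1. Qed.

Lemma sw_antipodeV X (b : H -> H -> X : vectType k) h : bilin b ->
  tlift b (D (T h)) = tlift (fun x y => b (T y) (T x)) (D h).
Proof.
move=> bl; rewrite Delta_antipodeV (@tlift_map _ _ _ _ _ _ (tlift b)).
by apply: eq_tlift => x y; rewrite tliftE.
Qed.

Lemma eps_antipodeV h : eps H (T h) = eps H h.
Proof.
have epl : lin (fun w => eps H w : k^o) by multilin.
have := sw_antipodeVl h epl; rewrite rmorph1 [RHS]mulr1 => <-.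
rewrite -(@sw_epsl _ H _ (fun w => eps H (T w) : k^o)); last by multilin.
by apply: eq_tlift => x y; rewrite rmorphM mulrC.
Qed.

Lemma dualactE (Z : fdmod K) a x v :
  dualact Z a (x ⊗ v) = tlift (fun h y => harpoon h x ⊗ fm_act Z y v) (rho a).
Proof. by rewrite comp_lfunE tlift_app; apply: eq_tlift => h y; rewrite tmapE. Qed.

Lemma evalat_dualact (Z : fdmod K) a s t :
  evalat t (dualact Z a s) = tlift (fun h y => fm_act Z y (evalat (T h * t) s)) (rho a).
Proof.
elim/tens_ind: s => [x v|c s s' IH IH'].
  rewrite dualactE tlift_map; apply: eq_tlift => h y.
  by rewrite !evalatE harpoonE linearZ.
rewrite !linearP /= IH IH'; apply/esym; apply: tlift_comb => h y.
by rewrite !linearP.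
Qed.

Lemma evalat_stabL (G : tens (Hdual H) 'Hom(V, W)) x v t :
  evalat t (stabL V W G (x ⊗ v)) =
  tlift (fun p q => (x q : k) *: evalat p G v) (D t).
Proof.
elim/tens_ind: G => [g f|c G G' IH IH'].
  rewrite stabLE evalatE comp_lfunE.
  have -> (c : k^o) : (c : k) *: f v = linfun (fun c : k^o => (c : k) *: f v) c.
    by rewrite linfunE //; multilin.
  rewrite tlift_map; apply: eq_tlift => p q; rewrite linfunE; last by multilin.
  by rewrite evalatE scale_lfunE scalerA mulrC.
rewrite linearP add_lfunE scale_lfunE linearP /= IH IH'; apply/esym; apply: tlift_comb => p q.
by rewrite linearP add_lfunE scale_lfunE scalerDr !scalerA mulrC.
Qed.

(** The equations G(t) a = a_(0) G(S^-1(a_(-1)) t), which can be compared both with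
    the stabilizer and with K-linear maps X ⊗ V -> W. *)
Definition twisted_linear (G : tens (Hdual H) 'Hom(V, W)) : Prop := forall a t v,
  evalat t G (fm_act V a v) =
  tlift (fun h x => fm_act W x (evalat (T h * t) G v)) (rho a).

(** Evaluated at t, the K-linearity of the operator stabL G on x ⊗ v reads
    x(S^-1(a_(-1)) t_2) G(t_1) a_(0) v = x(S^-1(a_(-2)) t_2) a_(0) G(S^-1(a_(-1)) t_1) v.
    The choice x = eps turns this into the equations for G; conversely these, used for
    a_(0) and t_1, give it for all x. *)
Lemma Stab_twisted_linear G : (stabL V W G \in Stab V W) <-> twisted_linear G.
Proof.
split=> [|tG].
  rewrite memv_cap => /andP[/intertwinersP GK _] a t v.
  pose e : Hdual H := ahval (eps H).
  have eT h q : e (T h * q) = (eps H h : k) * (eps H q : k).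
    by rewrite /e rmorphM -eps_antipodeV.
  have GE (x : Hdual H) :
      stabL V W G (dualact V a (x ⊗ v)) = dualact W a (stabL V W G (x ⊗ v)).
    by rewrite -!comp_lfunE GK.
  have := congr1 (evalat t) (GE e); rewrite dualactE evalat_dualact tlift_map tlift_map.
  under eq_tlift => h x.
    rewrite evalat_stabL.
    under eq_tlift => p q do rewrite harpoonE eT -scalerA.
    rewrite -scaler_tlift (@sw_epsr _ _ _ (fun p => evalat p G (fm_act V x v))); last first.
      by rewrite /evalat; multilin.
    over.
  rewrite (@sw_coact_counit _ (fun x => evalat t G (fm_act V x v))); last by multilin.
  move=> ->; apply: eq_tlift => h x; congr (fm_act W x _).
  rewrite evalat_stabL (@sw_epsr _ _ _ (fun p => evalat p G v)) //.
  by rewrite /evalat; multilin.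
rewrite memv_cap memv_img ?memvf // andbT; apply/intertwinersP=> a.
suff GE (x : Hdual H) v :
    stabL V W G (dualact V a (x ⊗ v)) = dualact W a (stabL V W G (x ⊗ v)).
  apply: text => x v; apply: etrans (comp_lfunE _ _ _) _; apply: etrans (GE x v) _.
  by apply/esym; apply: comp_lfunE.
apply: evalat_inj => t; rewrite dualactE evalat_dualact tlift_map tlift_map.
transitivity (tlift (fun h y => tlift (fun h' z => tlift (fun p q =>
   (x (T h * q) : k) *: fm_act W z (evalat (T h' * p) G v)) (D t)) (rho y)) (rho a)).
  apply: eq_tlift => h y; rewrite evalat_stabL [RHS]tlift_exchange.
  by apply: eq_tlift => p q; rewrite harpoonE tG scaler_tlift.
rewrite -(@sw_coact_assoc _ (fun h h' z => tlift (fun p q =>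
   (x (T h * q) : k) *: fm_act W z (evalat (T h' * p) G v)) (D t))); last first.
  by rewrite /evalat; split; multilin.
apply: eq_tlift => h z; rewrite evalat_stabL sw_mul; last by rewrite /evalat; multilin.
rewrite sw_antipodeV; last by rewrite /evalat; multilin.
rewrite tlift_map; apply: eq_tlift => p q; rewrite tlift_map; apply: eq_tlift => p' q'.
by rewrite linearZ.
Qed.

Local Notation R := (Stab_mod V W).
(** Elements of Stab_mod are carried by a subtype of H^* ⊗ Hom (V, W). *)
Definition stabfun (G : R) : tens (Hdual H) 'Hom(V, W) := vsval G.

Lemma stabfunP (G : R) : twisted_linear (stabfun G).
Proof. by apply/Stab_twisted_linear; have := subvsP G; rewrite -memv_preim. Qed.

Lemma stabfun_act h (G : R) t :
  evalat t (stabfun (fm_act R h G)) = evalat (t * h) (stabfun G).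
Proof.
rewrite /stabfun (fdsub_funE (@Stab_submodule _ _ _ V W)).
exact: stab_ambientE.
Qed.

Lemma caactE (X : fdmod H) (Z : fdmod K) a x z :
  fm_act (caact X Z) a (x ⊗ z) = tlift (fun h y => fm_act X h x ⊗ fm_act Z y z) (rho a).
Proof.
rewrite [fm_act _ _]comp_lfunE [fm_act _]/= /fdbox_act tlift_app.
by apply: eq_tlift => h y; rewrite tmapE.
Qed.

Definition stab_ev : 'Hom(tens R V, W) := tlift (fun (G : R) v => evalat 1 (stabfun G) v).

Lemma stab_evE G v : stab_ev (G ⊗ v) = evalat 1 (stabfun G) v.
Proof. by rewrite /stab_ev tliftE //; rewrite /stabfun; multilin. Qed.

(** At t = a_(-1) the equations for G give
    G(a_(-1)) a_(0) = a_(0) G(S^-1(a_(-1)) a_(-2)) = a G(1). *)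
Lemma stab_ev_hom : stab_ev \in fdhoms (caact R V) W.
Proof.
apply/intertwinersP=> a; suff E (G : R) v :
    stab_ev (fm_act (caact R V) a (G ⊗ v)) = fm_act W a (stab_ev (G ⊗ v)).
  apply: text => G v; apply: etrans (comp_lfunE _ _ _) _; apply: etrans (E G v) _.
  by apply/esym; apply: comp_lfunE.
rewrite caactE tlift_map stab_evE.
under eq_tlift => h x do rewrite stab_evE stabfun_act mul1r stabfunP.
rewrite -(@sw_coact_assoc _ (fun h q y =>
  fm_act W y (evalat (T q * h) (stabfun G) v))); last first.
  by rewrite /evalat; split; multilin.
under eq_tlift => h y.
  rewrite (@sw_antipodeVl _ _ _ (fun w => fm_act W y (evalat w (stabfun G) v))); last first.
    by rewrite /evalat; multilin.
  over.
by rewrite (@sw_coact_counit _ (fun y => fm_act W y (evalat 1 (stabfun G) v))); last by multilin.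
Qed.

Section Classify.
Variables (X : fdmod H) (phi : 'Hom(tens X V, W)).
Hypothesis phiK : phi \in fdhoms (caact X V) W.

Let phiE a x v : fm_act W a (phi (x ⊗ v)) =
  tlift (fun h y => phi (fm_act X h x ⊗ fm_act V y v)) (rho a).
Proof.
have /intertwinersP/(_ a)/lfunP/(_ (x ⊗ v)) := phiK.
move=> E; apply: etrans (esym (comp_lfunE _ _ _)) _; apply: etrans (esym E) _.
by apply: etrans (comp_lfunE _ _ _) _; rewrite caactE tlift_map.
Qed.

Definition classify_fun (x : X) : tens (Hdual H) 'Hom(V, W) :=
  tensfun (fun t => linfun (fun v => phi (fm_act X t x ⊗ v))).

Lemma classify_funE x t v : evalat t (classify_fun x) v = phi (fm_act X t x ⊗ v).
Proof.
rewrite evalat_tensfun ?linfunE //; first by multilin.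
move=> c t1 t2; apply/lfunP=> w; rewrite add_lfunE scale_lfunE !linfunE; try by multilin.
have l : lin (fun t => phi (fm_act X t x ⊗ w)) by multilin.
exact: l.
Qed.

Lemma classify_fun_lin : lin classify_fun.
Proof.
move=> c x y; apply: evalat_inj => t; apply/lfunP=> v.
rewrite linearP add_lfunE scale_lfunE !classify_funE.
have l : lin (fun x => phi (fm_act X t x ⊗ v)) by multilin.
exact: l.
Qed.

(** By linearity of phi the right side is
    phi (a_(-1) S^-1(a_(-2)) t x ⊗ a_(0) v). *)
Lemma classify_twisted_linear x : twisted_linear (classify_fun x).
Proof.
move=> a t v; rewrite classify_funE.
under eq_tlift => h y do rewrite classify_funE phiE.
rewrite -(@sw_coact_assoc _ (fun h q y =>
  phi (fm_act X q (fm_act X (T h * t) x) ⊗ fm_act V y v))); last first.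
  by split; multilin.
under eq_tlift => h y.
  under eq_tlift => p q do rewrite -comp_lfunE -fm_actM mulrA.
  rewrite (@sw_antipodeVr _ _ _ (fun w =>
    phi (fm_act X (w * t) x ⊗ fm_act V y v))); last first.
    by multilin.
  rewrite mul1r; over.
by rewrite (@sw_coact_counit _ (fun y => phi (fm_act X t x ⊗ fm_act V y v))); last by multilin.
Qed.

Lemma classify_mem x : classify_fun x \in (stabL V W @^-1: Stab V W)%VS.
Proof. by rewrite -memv_preim; apply/Stab_twisted_linear/classify_twisted_linear. Qed.

Definition classify : 'Hom(X, R) :=
  linfun (fun x => vsproj (stabL V W @^-1: Stab V W)%VS (classify_fun x)).

Lemma classifyE x : stabfun (classify x) = classify_fun x.
Proof.
rewrite /classify linfunE /stabfun ?vsprojK ?classify_mem // => c y z.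
by rewrite classify_fun_lin linearP.
Qed.

Lemma classify_hom : classify \in fdhoms X R.
Proof.
apply/intertwinersP=> h; apply/lfunP=> x; rewrite comp_lfunE [RHS]comp_lfunE.
apply: subvs_inj; apply: evalat_inj => t.
apply/lfunP=> v; rewrite -/(stabfun _) -/(stabfun _).
by rewrite stabfun_act !classifyE !classify_funE fm_actM comp_lfunE.
Qed.
End Classify.

(** Uniqueness: an H-linear f' is determined by its values at 1, as
    f'(x)(t) = (t f'(x))(1) = f'(t x)(1). *)
Lemma Stab_internal_hom : exists u, @internal_hom _ _ (catK K) V W R u.
Proof.
exists (Subvs stab_ev_hom) => X phi.
exists (Subvs (classify_hom (subvsP phi))); split.
  apply: subvs_inj; apply: text => x v; apply: etrans (comp_lfunE _ _ _) _.
  apply: etrans (congr1 stab_ev (tmapE _ _ _ _)) _.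
  by rewrite stab_evE (classifyE (subvsP phi)) classify_funE fm_act1 !id_lfunE.
move=> f' f'u; apply: subvs_inj; apply/lfunP=> x; apply: subvs_inj.
apply: evalat_inj => t; apply/lfunP=> v.
rewrite -/(stabfun _) -/(stabfun _) (classifyE (subvsP phi)) classify_funE.
rewrite -[t]mul1r -stabfun_act mul1r -stab_evE.
have /intertwinersP/(_ t)/lfunP/(_ x) := subvsP f'; rewrite !comp_lfunE => <-.
have /(congr1 vsval)/lfunP/(_ (fm_act X t x ⊗ v)) := f'u => <-.
by apply/esym; apply: etrans (comp_lfunE _ _ _) _; rewrite tmapE id_lfunE.
Qed.
End StabInternalHom.

(** * Dynamical data from module equivalences *)

Lemma charmod_idempotents (k : closedFieldType) (H : hopfAlg k) (A : glsubgroup H)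
    (mu : chargroup k A) (e : hom (charmod mu : Amod_cat A) (charmod mu)) :
  e ∘ e = e -> e = 0 \/ e = idm _.
Proof.
move=> ee; pose c : k := vsval e (1 : k^o).
have eE (x : k^o) : vsval e x = c * x.
  by rewrite -[x in LHS]mulr1 [LHS](linearZ _ (1 : k^o)) mulrC.
have /eqP : c * c = c by rewrite -eE {2}/c -[in RHS]ee /= comp_lfunE.
rewrite -subr_eq0 -{3}[c]mulr1 -mulrBr mulf_eq0 subr_eq0 => /orP[]/eqP c01.
  left; apply: subvs_inj; apply/lfunP=> x; apply: etrans (eE x) _.
  by rewrite c01 mul0r (linear0 vsval) zero_lfunE.
right; apply: subvs_inj; apply/lfunP=> x; apply: etrans (eE x) _.
by rewrite c01 mul1r id_lfunE.
Qed.

Theorem proposition3p18 (k : closedFieldType) (char0 : [pchar k] =i pred0)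
  (H : hopfAlg k) (A : glsubgroup H)
  (J : chargroup k A -> tens H H) (twistJ : dynamical_twist J)
  (K : comodAlg H) (Ksimple : Hsimple K) (Kco : coinvariants K = 1%VS)
  (F : modfunctor (catJ twistJ) (catK K)) (Fequiv : is_equivalence F) :
  dynamical_datum (fun lambda : chargroup k A => F (charmod lambda^-1%g)).
Proof.
have regK : vnregular (fdmod_cat K) := equiv_vnregular Fequiv (Amod_vnregular char0 (A := A)).
split=> //.
- exact: vnregular_completely_reducible.
- move=> l; have z1 : (0 : hom (charmod l^-1%g : Amod_cat A) (charmod l^-1%g)) <> idm _.
    move=> /(congr1 vsval)/lfunP/(_ (1 : k^o)); rewrite (linear0 vsval) zero_lfunE id_lfunE.
    by move/eqP; rewrite eq_sym oner_eq0.
  have [nz idem] := equiv_idempotents Fequiv z1 (@charmod_idempotents _ _ _ _).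
  exact: irreducible_of_idempotents.
move=> l m; have [u uP] := charmod_internal_hom twistJ l m.
have [v vP] := internal_hom_equiv Fequiv uP.
have [w wP] := Stab_internal_hom (F (charmod l^-1%g)) (F (charmod m^-1%g)).
exact: internal_hom_unique wP vP.
Qed.
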